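(* There is a tropical rational function $\varphi$ on $\mathbb{R}^2$ which has two different minimum volume expressions of positive volume. That is, there exist a tropical rational function $\varphi$ on $\mathbb{R}^2$ and tropical polynomials $f_1,g_1,f_2,g_2\in\mathbb{T}[x^{\pm1},y^{\pm1}]$ with $g_1,g_2\neq-\infty$ such that $\varphi=f_1\oslash g_1=f_2\oslash g_2$, such that $0<\mathrm{vol}(f_1,g_1)=\mathrm{vol}(f_2,g_2)\le\mathrm{vol}(f,g)$ for all $f,g\in\mathbb{T}[x^{\pm1},y^{\pm1}]$ with $g\neq-\infty$ and $\varphi=f\oslash g$, and such that the dual subdivision of $f_1\oplus(z\odot g_1)$ is not a translation of the dual subdivision of $f_2\oplus(z\odot g_2)$, where $z$ is a third variable.
   Context: Tropical algebra: $\mathbb{T}=\mathbb{R}\cup\{-\infty\}$ with $x\oplus y=\max\{x,y\}$, $x\odot y=x+y$, and $x\oslash y=x-y$ for $y\ne-\infty$. A tropical polynomial (always meaning tropical Laurent polynomial) in $n$ variables is a formal expression $f=\bigoplus_{\mathbf{i}\in\mathbb{Z}^n}c_{\mathbf{i}}\mathbf{x}^{\mathbf{i}}$ with $c_{\mathbf{i}}\in\mathbb{T}$, only finitely many $c_{\mathbf{i}}\neq-\infty$; the set of these is $\mathbb{T}[x_1^{\pm1},\dots,x_n^{\pm1}]$, with the natural $\oplus$ and $\odot$. The polynomial all of whose coefficients are $-\infty$ is denoted $-\infty$. A tropical polynomial defines a function $\mathbb{R}^n\to\mathbb{R}\cup\{-\infty\}$ by $f(\mathbf{t})=\max_{\mathbf{i}}(c_{\mathbf{i}}+\mathbf{i}\cdot\mathbf{t})$.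 For $g\neq-\infty$, $f\oslash g$ is the function $\mathbf{t}\mapsto f(\mathbf{t})-g(\mathbf{t})$. A tropical rational function on $\mathbb{R}^n$ is a function of the form $f\oslash g$ with $f,g$ tropical polynomials, $g\neq-\infty$; equalities $\varphi=f\oslash g$ are equalities of functions. Newton polytope and dual subdivision: $\mathrm{Newt}(f)\subset\mathbb{R}^n$ is the convex hull of $\{\mathbf{i}\in\mathbb{Z}^n\mid c_{\mathbf{i}}\neq-\infty\}$. Let $\Delta_f^{\uparrow}\subset\mathbb{R}^{n+1}$ be the convex hull of $\{(\mathbf{i},\alpha)\in\mathbb{Z}^n\times\mathbb{R}\mid\alpha\le c_{\mathbf{i}}\}$. The projections to $\mathbb{R}^n$ of the bounded faces of $\Delta_f^{\uparrow}$ form a lattice subdivision of $\mathrm{Newt}(f)$, called the dual subdivision of $f$. Volume of a pair: for $f,g\in\mathbb{T}[x_1^{\pm1},\dots,x_n^{\pm1}]$, $\mathrm{vol}(f,g)$ is the $(n+1)$-dimensional volume of $\mathrm{Newt}(f\oplus(x_{n+1}\odot g))\subset\mathbb{R}^{n+1}$ if its affine span has dimension $n+1$, and $\mathrm{vol}(f,g)=0$ otherwise. *)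

(* Defs.v *)
From HB Require Import structures.
From mathcomp Require Import all_boot all_order all_algebra finmap.
From mathcomp Require Import all_classical all_reals all_analysis.

Set Implicit Arguments.
Unset Strict Implicit.
Unset Printing Implicit Defensive.

Import Order.TTheory GRing.Theory Num.Theory.
Import numFieldNormedType.Exports.

Local Open Scope classical_set_scope.
Local Open Scope ring_scope.

Section TropicalSemifield.
Variable R : realType.

(* [option R] is R with -oo adjoined, [None] being -oo. *)
Definition trop_add (x y : option R) : option R :=
  match x, y with
  | Some a, Some b => Some (Num.max a b)
  | None, _ => y
  | _, None => x
  end.

Lemma trop_addA : associative trop_add.
Proof. by move=> [a|] [b|] [c|] //=; rewrite maxA. Qed.

Lemma trop_addC : commutative trop_add.
Proof. by move=> [a|] [b|] //=; rewrite maxC. Qed.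

Lemma trop_add0x : left_id None trop_add.
Proof. by []. Qed.

HB.instance Definition _ :=
  Monoid.isComLaw.Build (option R) None trop_add trop_addA trop_addC trop_add0x.

Definition trop_mul (x y : option R) : option R :=
  match x, y with
  | Some a, Some b => Some (a + b)
  | _, _ => None
  end.

Definition trop_ereal (x : option R) : \bar R :=
  if x is Some a then a%:E else -oo%E.

End TropicalSemifield.

Section TropicalPolynomials.
Variable R : realType.

(* Laurent polynomials in n variables: exponents range over Z^n. *)
Definition tpoly (n : nat) := {fsfun 'rV[int]_n -> option R with None}.

Definition tpoly_ninfty (n : nat) : tpoly n := [fsfun of _ => None].

Definition tpoly_add (n : nat) (f g : tpoly n) : tpoly n :=
  [fsfun i in (finsupp f `|` finsupp g)%fset => trop_add (f i) (g i) | None].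

Definition tpoly_mul (n : nat) (f g : tpoly n) : tpoly n :=
  [fsfun k in [fset (i + j)%R | i in finsupp f, j in finsupp g]%fset =>
     \big[@trop_add R/None]_(i <- finsupp f) trop_mul (f i) (g (k - i)) | None].

Definition tpoly_var (n : nat) (k : 'I_n) : tpoly n :=
  [fsfun i in [fset delta_mx 0%R k]%fset => Some 0 | None].

(* A polynomial in n variables seen as a polynomial in n + 1 variables, in which
   the last variable does not occur. *)
Definition tpoly_lift (n : nat) (f : tpoly n) : tpoly (n + 1) :=
  [fsfun i in [fset row_mx j 0%R | j in finsupp f]%fset => f (lsubmx i) | None].

(* f (+) (x_{n+1} (.) g) *)
Definition tpoly_pair (n : nat) (f g : tpoly n) : tpoly (n + 1) :=
  tpoly_add (tpoly_lift f)
    (tpoly_mul (tpoly_var (rshift n ord0)) (tpoly_lift g)).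

Definition dotp (n : nat) (u v : 'rV[R]_n) : R := \sum_(k < n) u 0 k * v 0 k.

Definition real_exp (n : nat) (i : 'rV[int]_n) : 'rV[R]_n :=
  map_mx (fun z : int => z%:~R) i.

Definition tpoly_eval (n : nat) (f : tpoly n) (t : 'rV[R]_n) : \bar R :=
  \big[maxe/-oo%E]_(i <- finsupp f)
    (trop_ereal (f i) + (dotp (real_exp i) t)%:E)%E.

(* Only meaningful for [g] different from -oo, so that [g] has finite values. *)
Definition trop_quot (n : nat) (f g : tpoly n) : 'rV[R]_n -> \bar R :=
  fun t => (tpoly_eval f t - tpoly_eval g t)%E.

Definition trop_rational (n : nat) (phi : 'rV[R]_n -> \bar R) : Prop :=
  exists f g : tpoly n, g <> tpoly_ninfty n /\ phi = trop_quot f g.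

End TropicalPolynomials.

Section Polytopes.
Variable R : realType.

Definition conv_hull (n : nat) (A : set 'rV[R]_n) : set 'rV[R]_n :=
  smallest (@convex_set R 'rV[R]_n) A.

Definition affine_set (n : nat) (A : set 'rV[R]_n) : Prop :=
  forall (x y : 'rV[R]_n) (t : R), A x -> A y -> A (t *: x + (1 - t) *: y).

Definition affine_span (n : nat) (A : set 'rV[R]_n) : set 'rV[R]_n :=
  smallest (@affine_set n) A.

Definition affine_span_dim (n : nat) (A : set 'rV[R]_n) (d : nat) : Prop :=
  exists (p : 'rV[R]_n) (U : {vspace 'rV[R]_n}),
    affine_span A = [set p + u | u in [set u | u \in U]] /\ \dim U = d.

(* The nonempty faces of the polyhedron P; u = 0 gives P itself. *)
Definition is_face (n : nat) (P F : set 'rV[R]_n) : Prop :=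
  F !=set0 /\
  exists u : 'rV[R]_n,
    F = [set p | P p /\ forall q, P q -> dotp u q <= dotp u p].

Definition newt (n : nat) (f : tpoly R n) : set 'rV[R]_n :=
  conv_hull [set real_exp R i | i in [set i | f i <> None]].

Definition upper_newt (n : nat) (f : tpoly R n) : set 'rV[R]_(n + 1) :=
  conv_hull [set p | exists (i : 'rV[int]_n) (a : R),
    (a%:E <= trop_ereal (f i))%E /\ p = row_mx (real_exp R i) (const_mx a)].

Definition dual_subdivision (n : nat) (f : tpoly R n) : set (set 'rV[R]_n) :=
  [set lsubmx @` F | F in
    [set F | is_face (upper_newt f) F /\ bounded_set F]].

Definition is_translation (n : nat) (S S' : set (set 'rV[R]_n)) : Prop :=
  exists v : 'rV[R]_n, S = [set [set x + v | x in C] | C in S'].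

Definition volume3 (A : set 'rV[R]_3) : \bar R :=
  ((lebesgue_measure \x lebesgue_measure) \x lebesgue_measure)%E
    [set p : R * R * R | A (\row_(k < 3) [:: p.1.1; p.1.2; p.2]`_k)].

Definition vol (f g : tpoly R 2) : \bar R :=
  if `[< affine_span_dim (newt (tpoly_pair f g)) 3 >]
  then volume3 (newt (tpoly_pair f g)) else 0%E.

End Polytopes.

(* Main.v *)
Require Import Defs.
From mathcomp Require Import all_boot all_order all_algebra finmap.
From mathcomp Require Import all_classical all_reals all_analysis.
From mathcomp Require Import measurable_realfun ring lra.

Set Implicit Arguments.
Unset Strict Implicit.
Unset Printing Implicit Defensive.

Import Order.TTheory GRing.Theory Num.Theory.
Import numFieldNormedType.Exports.

Local Open Scope classical_set_scope.
Local Open Scope ring_scope.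

(** The example.  Put F = max(x, y, -x-y) and
    G = max(F, x+y-1, -x-1, -y-1).  On the triangle where F <= 1 the three extra
    terms of G do not exceed F, so G = F there; off it both F and G are at least 1.
    Hence F - G = max(1, F) - max(1, G): the same bump, supported on
    the triangle, is added to the numerator and to the denominator.  The two
    expressions are (F, G) and (max(1, F), max(1, G)).  The exponent 0 of the new
    term lies inside the Newton triangle of F and inside the Newton hexagon of G,
    so both expressions have the same Newton polytope ([same_newt]) and the same
    volume.

    The dual subdivisions.  Raising the coefficient of the exponent 0 makes
    (0,0,0) and (0,0,1) vertices of the second subdivision.  A translation would
    carry its vertices (1,0,0) and (0,0,1) to exponents of F (+) (z (.) G), and no
    two of these differ by (-1,0,1) ([not_translation]).

    Minimality.  If f - g = F - G, dividing by l at the point l t and letting l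
    grow leaves an identity between the support functions of the four Newton
    polygons: h_f - h_g = h_F - h_G ([trop_quot_recession]).  Consider
    k = h_f - h_F = h_g - h_G.  A support function is linear near t unless t is
    normal to an edge of its polygon, and the triangle and the hexagon have no
    edge normal in common; so near each t other than 0, k is a convex function
    minus a linear one.  In the plane, such local convexity off the origin yields a
    global linear minorant v of k ([linear_minorant]).  By separation the
    inequalities h_F + v <= h_f and h_G + v <= h_g say that the translates by v of
    the triangle and of the hexagon lie in Newt(f) and Newt(g)
    ([no_common_normal_minimal]).  Thus the polytope of (f, g) contains a translate
    of the polytope of (F, G), and volume is monotone and invariant under
    translation ([volume3_le_translate]). *)

(** * Convex hulls *)

Lemma convex_setP (R : realType) (n : nat) (A : set 'rV[R]_n) :
  @convex_set R 'rV[R]_n A <->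
  forall (x y : 'rV[R]_n) (t : R), 0 <= t -> t <= 1 -> A x -> A y ->
    A (t *: x + (1 - t) *: y).
Proof.
split=> [cA x y t t0 t1 Ax Ay|cA x y l /set_mem Ax /set_mem Ay].
  have t01 : Itv.spec (@Itv.num_sem _) (Itv.Real `[0%Z, 1%Z]) t.
    by rewrite /= /Itv.num_sem /= num_real /= in_itv /= t0 t1.
  by have := cA x y (Itv.mk t01) (mem_set Ax) (mem_set Ay); move/set_mem.
apply/mem_set; exact: (cA x y l%:num).
Qed.

Lemma conv_hull_convex (R : realType) (n : nat) (A : set 'rV[R]_n) :
  @convex_set R 'rV[R]_n (conv_hull A).
Proof.
apply/convex_setP => x y t t0 t1 Ax Ay B [cB AB].
by apply: (convex_setP _).1 => //; [exact: Ax|exact: Ay].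
Qed.

Lemma sub_conv_hull (R : realType) (n : nat) (A : set 'rV[R]_n) :
  A `<=` conv_hull A.
Proof. by move=> x Ax B [_]; apply. Qed.

Lemma conv_hull_min (R : realType) (n : nat) (A B : set 'rV[R]_n) :
  @convex_set R 'rV[R]_n B -> A `<=` B -> conv_hull A `<=` B.
Proof. by move=> cB AB x; apply. Qed.

(** * Volume of convex sets in space *)

Local Open Scope ereal_scope.
Lemma ge0_le_integral_pointwise d (T : measurableType d) (R : realType)
    (mu : {measure set T -> \bar R}) (f g : T -> \bar R) :
  (forall x, 0 <= f x) -> (forall x, f x <= g x) ->
  \int[mu]_x f x <= \int[mu]_x g x.
Proof.
move=> f0 fg.
rewrite !ge0_integralTE//; last by move=> x; exact: le_trans (fg x).
apply: le_ereal_sup => _ [h hf <-]; exists h => // x.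
exact: le_trans (hf x) (fg x).
Qed.

Section InvariantIntegral.
Import HBNNSimple.

(** The integrand is arbitrary, so the change of variables is applied to the simple
    functions below it. *)
Lemma ge0_integral_invariant d (T : measurableType d) (R : realType)
    (mu : {measure set T -> \bar R}) (phi : T -> T) (f : T -> \bar R) :
  measurable_fun setT phi ->
  (forall A, measurable A -> mu (phi @^-1` A) = mu A) ->
  (forall x, 0 <= f x) ->
  \int[mu]_x f x <= \int[mu]_x f (phi x).
Proof.
move=> mphi inv f0; rewrite [leLHS]ge0_integralTE//.
apply: ge_ereal_sup => _ [h hf <-].
have -> : sintegral mu h = \int[mu]_x (h x)%:E.
  by rewrite integral_nnsfun// patch_setT.
have mh : measurable_fun setT (EFin \o (h : T -> R)) by exact/measurable_EFinP.
rewrite (eq_measure_integral (pushforward mu phi)); last first.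
  by move=> A mA _; rewrite -inv.
rewrite ge0_integral_pushforward//; last by move=> x _; rewrite lee_fin.
by apply: ge0_le_integral_pointwise => x /=; rewrite ?lee_fin// hf.
Qed.

End InvariantIntegral.

Lemma lebesgue_measure_shift (R : realType) (a : R) (A : set (measurableTypeR R)) :
  measurable A -> lebesgue_measure ((fun x => (x + a)%R) @^-1` A) = lebesgue_measure A.
Proof.
move=> mA; apply/esym.
have ms : measurable_fun setT
  ((fun x => (x + a)%R) : measurableTypeR R -> measurableTypeR R).
  by apply: measurable_funD.
apply: (@lebesgue_measure_unique R (pushforward lebesgue_measure
  ((fun x => (x + a)%R) : measurableTypeR R -> measurableTypeR R))) => //=.
move=> _ [[x y]] _ <-.
rewrite /pushforward.
have -> : (fun x0 => (x0 + a)%R) @^-1` `]x, y] = `](x - a)%R, (y - a)%R]%classic.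
  by apply/seteqP; split => z /=; rewrite !in_itv/= ltrBlDr lerBrDr.
rewrite !lebesgue_measure_itv/= !lte_fin ltrD2r.
by case: ifP => // _; rewrite -!EFinB; congr EFin; lra.
Qed.

Lemma lebesgue_measure2_shift (R : realType) (a b : R)
    (A : set (measurableTypeR R * measurableTypeR R)) : measurable A ->
  (lebesgue_measure \x lebesgue_measure)
    ((fun p : R * R => (p.1 + a, p.2 + b)%R) @^-1` A) =
  (lebesgue_measure \x lebesgue_measure) A.
Proof.
move=> mA; apply/esym.
pose phi : measurableTypeR R * measurableTypeR R ->
  measurableTypeR R * measurableTypeR R := (fun p => (p.1 + a, p.2 + b)%R).
have mphi : measurable_fun setT phi.
  by apply: measurable_fun_pair; apply: measurable_funD.
apply: (@product_measure_unique _ _ _ _ _ _ _ (pushforward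
  (lebesgue_measure \x lebesgue_measure) phi)) => // B C mB mC.
have ms c : measurable_fun setT
  ((fun x => (x + c)%R) : measurableTypeR R -> measurableTypeR R).
  by apply: measurable_funD.
have mp c D : measurable D -> measurable (((fun x => (x + c)%R) :
   measurableTypeR R -> measurableTypeR R) @^-1` D).
  by move=> mD; rewrite -[X in measurable X]setTI; exact: ms.
have : (lebesgue_measure \x lebesgue_measure)
   (((fun x => (x + a)%R) @^-1` B) `*` ((fun x => (x + b)%R) @^-1` C)) =
  lebesgue_measure B * lebesgue_measure C.
  rewrite product_measure1E; [|exact: mp..].
  by congr (_ * _); exact: lebesgue_measure_shift.
exact.
Qed.
Local Close Scope ereal_scope.

Definition row3 (R : realType) (x y z : R) : 'rV[R]_3 :=
  \row_(k < 3) [:: x; y; z]`_k.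

Lemma row3_eta (R : realType) (u : 'rV[R]_3) :
  u = row3 (u 0 0) (u 0 1) (u 0 (2%:R)).
Proof.
apply/rowP => i; rewrite !mxE.
by case: i => [[|[|[|//]]] ?] /=; congr (u _ _); apply/val_inj.
Qed.

Lemma row3D (R : realType) (x y z a b c : R) :
  row3 x y z + row3 a b c = row3 (x + a) (y + b) (z + c).
Proof.
by apply/rowP => i; rewrite !mxE; case: i => [[|[|[|//]]] ?].
Qed.

Lemma row3Z (R : realType) (x y z a : R) :
  a *: row3 x y z = row3 (a * x) (a * y) (a * z).
Proof.
by apply/rowP => i; rewrite !mxE; case: i => [[|[|[|//]]] ?].
Qed.

Lemma convex_measurable_slice (R : realType) (A : set 'rV[R]_3) (x y : R) :
  @convex_set R 'rV[R]_3 A ->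
  measurable ([set z | A (row3 x y z)] : set (measurableTypeR R)).
Proof.
move=> /convex_setP cA; apply: is_interval_measurable.
move=> a b /= Aa Ab c /andP[ac cb].
have [eab|nab] := eqVneq a b; first by have -> : c = a by lra.
have ab : 0 < b - a by rewrite subr_gt0 lt_neqAle nab (le_trans ac cb).
have t0 : 0 <= (c - a) / (b - a) by rewrite divr_ge0// ?subr_ge0// (le_trans ac cb).
have t1 : (c - a) / (b - a) <= 1 by rewrite ler_pdivrMr// mul1r lerD2r.
have := cA _ _ _ t0 t1 Ab Aa.
rewrite !row3Z row3D.
have -> : (c - a) / (b - a) * x + (1 - (c - a) / (b - a)) * x = x by ring.
have -> : (c - a) / (b - a) * y + (1 - (c - a) / (b - a)) * y = y by ring.
have -> : (c - a) / (b - a) * b + (1 - (c - a) / (b - a)) * a = c.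
  by field; rewrite gt_eqF.
exact.
Qed.

(** Only the slices of the bodies in the last coordinate are known to be
    measurable: they are intervals, so the inner measure is a genuine length.  The
    outer integral is a supremum over simple functions, hence monotone and invariant
    for arbitrary nonnegative integrands. *)
Lemma volume3_le_translate (R : realType) (A B : set 'rV[R]_3) (v : 'rV[R]_3) :
  @convex_set R 'rV[R]_3 A -> @convex_set R 'rV[R]_3 B ->
  (forall x, A x -> B (x + v)) -> (volume3 A <= volume3 B)%E.
Proof.
move=> cA cB AB; rewrite /volume3.
pose F (C : set 'rV[R]_3) (p : R * R) : \bar R :=
  lebesgue_measure [set z | C (row3 p.1 p.2 z)].
have FE (C : set 'rV[R]_3) :
  ((lebesgue_measure \x lebesgue_measure) \x lebesgue_measure)%E
    [set p : R * R * R | C (\row_(k < 3) [:: p.1.1; p.1.2; p.2]`_k)] =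
  (\int[(lebesgue_measure \x lebesgue_measure)%E]_p F C p)%E.
  apply: eq_integral => p _ /=; congr lebesgue_measure.
  by apply/seteqP; split => z; rewrite /xsection /= inE.
rewrite !FE.
have F0 C p : (0 <= F C p)%E by exact: measure_ge0.
pose a := v 0 0; pose b := v 0 1; pose c := v 0 2%:R.
have FAB p : (F A p <= F B (p.1 + a, p.2 + b)%R)%E.
  rewrite /F -[leRHS](@lebesgue_measure_shift R c); last first.
    exact: convex_measurable_slice.
  apply: le_measure; rewrite ?inE.
  - exact: convex_measurable_slice.
  - have := @convex_measurable_slice R [set x | B (x + v)] p.1 p.2.
    rewrite /preimage/=.
    have -> : [set z | [set x | B (x + v)] (row3 p.1 p.2 z)] =
       [set t | B (row3 (p.1 + a) (p.2 + b) (t + c))].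
      by apply/seteqP; split => z /=; rewrite {1}(row3_eta v) row3D.
    apply; apply/convex_setP => x y t t0 t1 /= Bx By.
    have -> : t *: x + (1 - t) *: y + v = t *: (x + v) + (1 - t) *: (y + v).
      by rewrite !scalerDr addrACA -scalerDl addrC subrKC scale1r addrC.
    exact: (convex_setP _).1.
  - by move=> z /= /AB; rewrite {1}(row3_eta v) row3D.
pose mu2 : {measure set (measurableTypeR R * measurableTypeR R) -> \bar R} :=
  (lebesgue_measure \x lebesgue_measure)%E.
have FAB' := @ge0_le_integral_pointwise _ _ R mu2 _ _ (F0 A) FAB.
apply: (le_trans FAB').
have mphi : measurable_fun setT ((fun p => (p.1 + - a, p.2 + - b)%R) :
  measurableTypeR R * measurableTypeR R ->
  measurableTypeR R * measurableTypeR R).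
  by apply: measurable_fun_pair; apply: measurable_funD.
have inv C : measurable C -> mu2 ((fun p => (p.1 + - a, p.2 + - b)%R) @^-1` C)
    = mu2 C by exact: lebesgue_measure2_shift.
have := @ge0_integral_invariant _ _ R mu2 _
  (fun p => F B (p.1 + a, p.2 + b)%R) mphi inv (fun p => F0 B _).
move=> /le_trans; apply.
rewrite le_eqVlt; apply/orP; left; apply/eqP.
by apply: eq_integral => -[x y] _ /=; rewrite !subrK.
Qed.

Lemma volume3_gt0 (R : realType) (A : set 'rV[R]_3) (e : R) :
  0 < e -> @convex_set R 'rV[R]_3 A ->
  (forall x y z, 0 <= x <= e -> 0 <= y <= e -> 0 <= z <= e -> A (row3 x y z)) ->
  (0 < volume3 A)%E.
Proof.
move=> e0 cA AB.
pose I : set (measurableTypeR R) := `[0, e]%classic.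
have mI : measurable I by exact: measurable_itv.
have lI : lebesgue_measure I = e%:E.
  by rewrite lebesgue_measure_itv/= lte_fin e0 oppr0 adde0.
have V2 : (lebesgue_measure \x lebesgue_measure)%E (I `*` I) = (e * e)%:E.
  have := product_measure1E (@lebesgue_measure R) (@lebesgue_measure R) mI mI.
  by move=> ->; rewrite EFinM; congr (_ * _)%E.
have : ((lebesgue_measure \x lebesgue_measure) \x lebesgue_measure)%E
   ((I `*` I) `*` I) = (e * e * e)%:E :> \bar R.
  have := product_measure1E (lebesgue_measure \x lebesgue_measure)%E
    (@lebesgue_measure R) (measurableX mI mI) mI.
  by move=> ->; rewrite EFinM -V2; congr (_ * _)%E.
move=> V; apply: (@lt_le_trans _ _ (e * e * e)%:E); first by rewrite lte_fin !mulr_gt0.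
rewrite -V; apply: ge0_le_integral_pointwise => [p|p]; first exact: measure_ge0.
rewrite /=; apply: le_measure; rewrite ?inE.
- by apply: measurable_xsection; apply: measurableX => //; apply: measurableX.
- have := @convex_measurable_slice R A p.1 p.2 cA.
  by congr measurable; apply/seteqP; split => z; rewrite /xsection /= inE.
move=> z; rewrite /xsection/= !inE/= => -[[p1 p2] pz].
by apply: AB; move: p1 p2 pz; rewrite /I/= !in_itv/=.
Qed.

(** * Separation from a finite set *)

Lemma dotpDl (R : realType) (n : nat) (u v t : 'rV[R]_n) :
  dotp (u + v) t = dotp u t + dotp v t.
Proof. by rewrite /dotp -big_split; apply: eq_bigr => i _; rewrite mxE mulrDl. Qed.

Lemma dotpZl (R : realType) (n : nat) (a : R) (u t : 'rV[R]_n) :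
  dotp (a *: u) t = a * dotp u t.
Proof. by rewrite /dotp mulr_sumr; apply: eq_bigr => i _; rewrite mxE mulrA. Qed.

Lemma dotpC (R : realType) (n : nat) (u v : 'rV[R]_n) : dotp u v = dotp v u.
Proof. by apply: eq_bigr => i _; rewrite mulrC. Qed.

Lemma dotpDr (R : realType) (n : nat) (u v t : 'rV[R]_n) :
  dotp t (u + v) = dotp t u + dotp t v.
Proof. by rewrite dotpC dotpDl !(dotpC t). Qed.

Lemma dotpZr (R : realType) (n : nat) (a : R) (u t : 'rV[R]_n) :
  dotp t (a *: u) = a * dotp t u.
Proof. by rewrite dotpC dotpZl (dotpC t). Qed.

Lemma dotpNl (R : realType) (n : nat) (u t : 'rV[R]_n) :
  dotp (- u) t = - dotp u t.
Proof. by rewrite -scaleN1r dotpZl mulN1r. Qed.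

Lemma dotpNr (R : realType) (n : nat) (u t : 'rV[R]_n) :
  dotp t (- u) = - dotp t u.
Proof. by rewrite dotpC dotpNl (dotpC t). Qed.

Lemma dotpBl (R : realType) (n : nat) (u v t : 'rV[R]_n) :
  dotp (u - v) t = dotp u t - dotp v t.
Proof. by rewrite dotpDl dotpNl. Qed.

Lemma dotp_ge0 (R : realType) (n : nat) (u : 'rV[R]_n) : 0 <= dotp u u.
Proof. by apply: sumr_ge0 => i _; rewrite -expr2 sqr_ge0. Qed.

Lemma dotp_eq0 (R : realType) (n : nat) (u : 'rV[R]_n) : dotp u u = 0 -> u = 0.
Proof.
move=> /eqP; rewrite psumr_eq0 => [/allP u0|i _]; last by rewrite -expr2 sqr_ge0.
apply/rowP => i; rewrite mxE; apply/eqP.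
by have := u0 i; rewrite mem_index_enum mulf_eq0 orbb => /(_ isT).
Qed.

Lemma dotp_line (R : realType) (n : nat) (u v : 'rV[R]_n) (e : R) :
  dotp (u + e *: (v - u)) (u + e *: (v - u)) =
  dotp u u - 2 * e * (dotp u u - dotp u v) + e ^+ 2 * dotp (v - u) (v - u).
Proof.
rewrite !(dotpDl, dotpDr, dotpZl, dotpZr, dotpNl, dotpNr) (dotpC v u).
by ring.
Qed.

Lemma dotp_continuous (R : realType) (n : nat) (u : 'rV[R]_n) :
  continuous (dotp u).
Proof.
rewrite /dotp; apply: continuous_big => [|i _ t].
- exact: add_continuous.
- by apply: continuousM; [exact: cst_continuous|exact: coord_continuous].
Qed.

(** Split off the first point and renormalise the other weights. *)
Lemma convex_sum (R : realType) (n : nat) (C : set 'rV[R]_n) (m : nat)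
    (l : 'I_m -> R) (a : 'I_m -> 'rV[R]_n) :
  @convex_set R 'rV[R]_n C -> (forall i, 0 <= l i) -> \sum_i l i = 1 ->
  (forall i, C (a i)) -> C (\sum_i l i *: a i).
Proof.
move=> /convex_setP cC; elim: m l a => [|m IH] l a l0.
  by rewrite big_ord0 => /eqP; rewrite eq_sym oner_eq0.
rewrite !big_ord_recl => l1 Ca.
have s0 : 0 <= \sum_(i < m) l (lift ord0 i) by apply: sumr_ge0.
have [s00|s0N] := eqVneq (\sum_(i < m) l (lift ord0 i)) 0.
  move: l1; rewrite s00 addr0 => ->; rewrite scale1r big1 ?addr0// => i _.
  move/eqP: s00; rewrite psumr_eq0// => /allP /(_ i).
  by rewrite mem_index_enum => /(_ isT) /eqP ->; rewrite scale0r.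
have lE : \sum_(i < m) l (lift ord0 i) = 1 - l ord0 by rewrite -l1 addrAC subrr add0r.
rewrite lE in s0 s0N.
have -> : \sum_(i < m) l (lift ord0 i) *: a (lift ord0 i) =
  (1 - l ord0) *: \sum_(i < m) (l (lift ord0 i) / (1 - l ord0)) *: a (lift ord0 i).
  rewrite scaler_sumr; apply: eq_bigr => i _.
  by rewrite scalerA mulrC divfK.
apply: cC => //; first by rewrite -subr_ge0.
apply: IH => //; first by move=> i; rewrite divr_ge0.
by rewrite -mulr_suml lE divff.
Qed.

(** The nearest point q to w in the hull exists because the simplex of
    coefficients is compact; since moving from q towards a vertex does not decrease
    the distance to w, the vector w - q separates. *)
Lemma separation (R : realType) (n m : nat) (a : 'I_m.+1 -> 'rV[R]_n)
    (w : 'rV[R]_n) :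
  ~ conv_hull [set a i | i in setT] w ->
  exists t, forall i, dotp (a i) t < dotp w t.
Proof.
move=> nw.
pose L : set 'rV[R]_m.+1 :=
  [set l | (forall i, `[0, 1]%classic (l ord0 i)) /\ \sum_i l ord0 i = 1].
pose x (l : 'rV[R]_m.+1) : 'rV[R]_n := \sum_i l ord0 i *: a i - w.
pose box : set 'rV[R]_m.+1 := [set l | forall i, `[0, 1]%classic (l ord0 i)].
have cbox : compact box.
  by apply: (@rV_compact R _ (fun=> `[0, 1]%classic)) => i; exact: segment_compact.
have cL : compact L.
  apply: (@subclosed_compact _ L box) => //; last by move=> l [].
  have -> : L = box `&` (fun l : 'rV[R]_m.+1 => \sum_i l ord0 i) @^-1` [set 1] by [].
  apply: closedI; first by apply: compact_closed => //; exact: norm_hausdorff.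
  apply: (continuous_closedP _).1; last exact: closed_eq.
  apply: continuous_big => [|i _]; last exact: coord_continuous.
  exact: add_continuous.
have L0 : L !=set0.
  exists (delta_mx 0 0); split => [i|].
    by rewrite /= in_itv/= mxE eqxx /=; case: (i == 0); rewrite /= ?lexx ?ler01.
  rewrite /= (bigD1 0)//= big1 ?addr0; first by rewrite mxE !eqxx.
  by move=> i /negbTE i0; rewrite mxE i0 andbF.
have cf : continuous (fun l => dotp (x l) (x l)).
  apply: continuous_big => [|k _ l]; first exact: add_continuous.
  have cx : continuous (fun l => x l 0 k).
    rewrite (_ : (fun l => _) =
      (fun l : 'rV[R]_m.+1 => \sum_i l ord0 i * a i 0 k - w 0 k)); last first.
      apply/funext => ?; rewrite !mxE summxE; congr (_ - _).
      by apply: eq_bigr => i _; rewrite mxE.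
    move=> l'; apply: continuousB; last exact: cst_continuous.
    apply: continuous_big => [|i _ l'']; first exact: add_continuous.
    by apply: continuousM; [exact: coord_continuous|exact: cst_continuous].
  by apply: continuousM; exact: cx.
have [l /set_mem [l01 l1] lmin] := compact_EVT_min L0 cL (continuous_subspaceT cf).
have x0 : x l != 0.
  apply/eqP => xl0; apply: nw.
  have -> : w = \sum_i l ord0 i *: a i by apply/esym/eqP; rewrite -subr_eq0 -/(x l) xl0.
  apply: convex_sum => //; first exact: conv_hull_convex.
  - by move=> i; have := l01 i; rewrite /= in_itv/= => /andP[].
  - by move=> i; apply: sub_conv_hull; exists i.
have q0 : 0 < dotp (x l) (x l).
  by rewrite lt_neqAle dotp_ge0 andbT eq_sym; apply: contra x0 => /eqP/dotp_eq0 ->.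
exists (- x l) => i.
pose b := a i - w.
suff : dotp (x l) (x l) <= dotp (x l) b.
  move=> h; rewrite !dotpNr ltrN2 -subr_gt0 -dotpBl dotpC.
  exact: lt_le_trans h.
rewrite leNgt; apply/negP => lt.
pose c := dotp (x l) (x l) - dotp (x l) b.
have c0 : 0 < c by rewrite subr_gt0.
pose Q := dotp (b - x l) (b - x l).
have Q0 : 0 <= Q by exact: dotp_ge0.
(* Any e in ]0,1] with e * Q < 2 * c brings the point closer to w. *)
pose e := c / (Q + c).
have Qc : 0 < Q + c by rewrite ltr_wpDl.
have e0 : 0 < e by rewrite divr_gt0.
have e1 : e <= 1 by rewrite /e ler_pdivrMr// mul1r lerDr.
pose l' := (1 - e) *: l + e *: delta_mx 0 i.
have Ll' : L l'.
  split => [j|].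
    have := l01 j; rewrite /= !in_itv/= => /andP[lj0 lj1].
    rewrite /l' !mxE eqxx /=; case: (j == i) => /=; apply/andP; split; nra.
  rewrite /l'; under eq_bigr do rewrite !mxE eqxx /=.
  rewrite big_split/= -!mulr_sumr l1 (bigD1 i)//= eqxx big1 /=; first by ring.
  by move=> j /negbTE ->.
have xl' : x l' = x l + e *: (b - x l).
  rewrite /x (eq_bigr (fun j => (1 - e) *: (l ord0 j *: a j) +
    e *: ((j == i)%:R *: a j))) => [|j _]; last first.
    by rewrite /l' !mxE eqxx /= !scalerA -scalerDl.
  rewrite big_split/= -!scaler_sumr.
  have -> : \sum_j (j == i)%:R *: a j = a i.
    rewrite (bigD1 i)//= eqxx scale1r big1 ?addr0// => j /negbTE ->.
    by rewrite scale0r.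
  by apply/rowP => k; rewrite !mxE; ring.
have := lmin l' (mem_set Ll').
rewrite xl' dotp_line -/Q -/c => le.
have : 0 <= e * (e * Q - 2 * c) by lra.
rewrite pmulr_rge0// subr_ge0.
apply/negP; rewrite -ltNge.
have : e * Q <= c.
  rewrite /e mulrAC ler_pdivrMr//.
  by rewrite ler_pM2l// lerDl ltW.
by move: c0; lra.
Qed.

(** The support function of the convex hull of S.  The neutral element of the maximum
    is one of its terms, so it does not affect the value when S is not empty. *)
Definition suppf (R : realType) (n : nat) (S : seq 'rV[R]_n) (t : 'rV[R]_n) : R :=
  \big[Num.max/dotp (head 0 S) t]_(u <- S) dotp u t.

Lemma suppf_ge (R : realType) (n : nat) (S : seq 'rV[R]_n) (u t : 'rV[R]_n) :
  u \in S -> dotp u t <= suppf S t.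
Proof. by move=> uS; apply: (@le_bigmax_seq _ _ _ _ _ u xpredT (fun u => dotp u t)). Qed.

Lemma suppf_attained (R : realType) (n : nat) (S : seq 'rV[R]_n) (t : 'rV[R]_n) :
  S != [::] -> exists2 u, u \in S & suppf S t = dotp u t.
Proof.
move=> S0; have hS : head 0 S \in S by case: S S0 => //= ? ? _; rewrite mem_head.
rewrite /suppf big_seq.
apply: (big_ind (fun x => exists2 u, u \in S & x = dotp u t)).
- by exists (head 0 S).
- by move=> x y xS yS; case: leP.
- by move=> u uS; exists u.
Qed.

Lemma suppf_continuous (R : realType) (n : nat) (S : seq 'rV[R]_n) :
  continuous (suppf S).
Proof.
rewrite /suppf; move: (head 0 S) => h; elim: S => [|u s IH].
  rewrite (_ : (fun t => _) = dotp h); first exact: dotp_continuous.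
  by apply/funext => t; rewrite big_nil.
rewrite (_ : (fun t => _) = (fun t =>
  Num.max (dotp u t) (\big[Num.max/dotp h t]_(u <- s) dotp u t))); last first.
  by apply/funext => t; rewrite big_cons.
move=> t; apply: (@continuous_max _ _ (dotp u : _ -> R^o)) => //.
  exact: dotp_continuous.
exact: IH.
Qed.

(** The support function determines the convex hull. *)
Lemma separation_suppf (R : realType) (n : nat) (S : seq 'rV[R]_n) (w : 'rV[R]_n) :
  S != [::] -> (forall t, dotp w t <= suppf S t) ->
  conv_hull [set u | u \in S] w.
Proof.
move=> S0 wS; apply: contrapT => nw.
have sS : size S = (size S).-1.+1 by case: S S0 {wS nw}.
have [|t tlt] := @separation R n (size S).-1 (fun i => S`_i) w.
  move=> h; apply: nw; move: h; apply: conv_hull_min; first exact: conv_hull_convex.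
  move=> _ [i _ <-]; apply: sub_conv_hull => /=.
  by apply: mem_nth; apply: leq_trans (ltn_ord i) _; rewrite -sS.
have [u uS uE] := suppf_attained t S0.
have := wS t; rewrite uE leNgt => /negP; apply.
have iu : (index u S < (size S).-1.+1)%N by rewrite -sS index_mem.
by have := tlt (Ordinal iu); rewrite /= nth_index.
Qed.

(** * From local convexity to a linear minorant *)

(** A locally convex function of one variable that starts at 0 and is nonnegative
    at first cannot become negative.  Otherwise, subtract its chord and add a small
    strictly convex parabola: the sum has an interior maximum, which a
    supporting line at that point rules out. *)
Lemma nonneg_of_local_support (R : realType) (k : R -> R) :
  continuous k -> k 0 = 0 ->
  (exists2 r, 0 < r & forall s, 0 <= s -> s < r -> 0 <= k s) ->
  (forall c, 0 < c -> c < 1 -> exists m r, 0 < r /\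
     forall s, `|s| < r -> k c + s * m <= k (c + s)) ->
  0 <= k 1.
Proof.
move=> ck k0 [r r0 kr] sup; rewrite leNgt; apply/negP => k1.
pose e := - k 1.
have e0 : 0 < e by rewrite oppr_gt0.
(* g 0 = g 1 = 0, and g is positive just after 0. *)
pose g s := k s + s * e + (e / 2) * (s * (s - 1)).
have cg : continuous g.
  move=> s; rewrite /g /continuous_at.
  apply: cvgD; last first.
    apply: cvgM; first exact: cvg_cst.
    by apply: cvgM; [exact: cvg_id|apply: cvgB; [exact: cvg_id|exact: cvg_cst]].
  apply: cvgD; first exact: ck.
  by apply: cvgM; [exact: cvg_id|exact: cvg_cst].
have [c cI cmax] := EVT_max ler01 (continuous_subspaceT cg).
pose s0 := Num.min (r / 2) (1 / 2).
have s00 : 0 < s0 by rewrite lt_min; apply/andP; split; lra.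
have s0r : s0 < r.
  by apply: le_lt_trans (_ : r / 2 < r); [rewrite ge_min lexx|lra].
have s01 : s0 <= 1 / 2 by rewrite ge_min lexx orbT.
have gs0 : 0 < g s0.
  have ks0 := kr _ (ltW s00) s0r.
  have : 0 < s0 * e * (1 + s0) / 2 by rewrite divr_gt0// !mulr_gt0//; lra.
  by rewrite /g; lra.
have gc : 0 < g c.
  by apply: lt_le_trans gs0 _; apply: cmax; rewrite in_itv/=; apply/andP; split; lra.
have {cI} [c0 c1] : 0 < c /\ c < 1.
  move: cI; rewrite in_itv/= => /andP[c0 c1].
  split; rewrite lt_neqAle ?c0 ?c1 andbT; apply/negP => /eqP ec; move: gc.
    by rewrite -ec /g k0; lra.
  by rewrite ec /g /e; lra.
have [m [r' [r'0 sup']]] := sup c c0 c1.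
pose h := Num.min (r' / 2) (Num.min (c / 2) ((1 - c) / 2)).
have h0 : 0 < h by rewrite !lt_min; apply/and3P; split; lra.
have hr : h < r'.
  by apply: le_lt_trans (_ : r' / 2 < r'); [rewrite ge_min lexx|lra].
have hc : h <= c / 2 by rewrite !ge_min lexx orbT.
have hc1 : h <= (1 - c) / 2 by rewrite !ge_min lexx !orbT.
have h1 : k c + h * m <= k (c + h) by apply: sup'; rewrite gtr0_norm.
have h2 : k c + (- h) * m <= k (c + (- h)) by apply: sup'; rewrite normrN gtr0_norm.
have g1 : g (c + h) <= g c by apply: cmax; rewrite in_itv/=; apply/andP; split; lra.
have g2 : g (c + - h) <= g c by apply: cmax; rewrite in_itv/=; apply/andP; split; lra.
have : 0 < e * h ^+ 2 by rewrite mulr_gt0// exprn_gt0.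
by move: g1 g2; rewrite /g; lra.
Qed.

(** An affine lower bound that touches k at t0 and holds on a short segment
    around t0 in each direction d; the length of the segment may depend on d. *)
Definition locally_supported (R : realType) (n : nat) (k : 'rV[R]_n -> R)
    (t0 : 'rV[R]_n) : Prop :=
  exists2 v, k t0 = dotp v t0 & forall d, exists2 r, 0 < r &
    forall s, `|s| < r -> dotp v (t0 + s *: d) <= k (t0 + s *: d).

(** Local convexity is not assumed at 0.  A supporting form v at one point s still
    bounds k along any segment from s that avoids 0, and in the plane these segments reach
    every point off the line spanned by s; the points of that line are limits of the
    others. *)
Lemma linear_minorant (R : realType) (k : 'rV[R]_2 -> R) :
  continuous k -> (forall t, t != 0 -> locally_supported k t) ->
  exists v, forall t, dotp v t <= k t.
Proof.
move=> ck sup.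
pose s : 'rV[R]_2 := delta_mx 0 0.
pose w : 'rV[R]_2 := delta_mx 0 1.
have s0 : s != 0.
  apply/eqP => /rowP /(_ 0); rewrite !mxE/= => /eqP; exact/negP/oner_neq0.
have [v kv vloc] := sup _ s0; exists v.
(* For t off the line of s, the segment from s to t avoids 0. *)
have off (t : 'rV[R]_2) : t 0 1 != 0 -> dotp v t <= k t.
  move=> t1.
  pose g (x : R) := k (s + x *: (t - s)) - dotp v (s + x *: (t - s)).
  have cl : continuous (fun x : R => s + x *: (t - s)).
    move=> x; apply: cvgD; first exact: cvg_cst.
    by apply: cvgZr_tmp; exact: cvg_id.
  suff : 0 <= g 1 by rewrite /g scale1r subrKC subr_ge0.
  apply: nonneg_of_local_support.
  - move=> x; apply: cvgB.
      by apply: (@continuous_comp _ _ _ (fun x : R => s + x *: (t - s)));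
        [exact: cl|exact: ck].
    by apply: (@continuous_comp _ _ _ (fun x : R => s + x *: (t - s)));
        [exact: cl|exact: dotp_continuous].
  - by rewrite /g scale0r addr0 kv subrr.
  - have [r r0 vr] := vloc (t - s); exists r => // x x0 xr.
    by rewrite subr_ge0; apply: vr; rewrite ger0_norm.
  - move=> c c0 c1.
    have : s + c *: (t - s) != 0.
      apply/eqP => /rowP /(_ 1); rewrite !mxE/= subr0 add0r => /eqP.
      by rewrite mulf_eq0 (negbTE t1) orbF gt_eqF.
    move=> /sup[v' kv' /(_ (t - s))[r r0 v'r]].
    exists (dotp v' (t - s) - dotp v (t - s)), r; split => // x xr.
    have := v'r _ xr; rewrite /g -addrA -scalerDl kv'.
    rewrite !(dotpDr, dotpZr); lra.
move=> t; have [t1|] := eqVneq (t 0 1) 0; last exact: off.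
rewrite leNgt; apply/negP => tlt.
have cl : continuous (fun x : R => dotp v (t + x *: w) - k (t + x *: w)).
  have cl' : continuous (fun x : R => t + x *: w).
    move=> x; apply: cvgD; first exact: cvg_cst.
    by apply: cvgZr_tmp; exact: cvg_id.
  move=> x; apply: cvgB.
    by apply: (@continuous_comp _ _ _ (fun x : R => t + x *: w));
      [exact: cl'|exact: dotp_continuous].
  by apply: (@continuous_comp _ _ _ (fun x : R => t + x *: w));
      [exact: cl'|exact: ck].
have : \forall x \near 0, 0 < dotp v (t + x *: w) - k (t + x *: w).
  apply: (cvgr_gt _ (cl 0)).
  by rewrite scale0r addr0 subr_gt0.
move=> /nbhs_ballP[e /= e0 he].
have : 0 < dotp v (t + (e / 2) *: w) - k (t + (e / 2) *: w).
  by apply: he; rewrite /ball/= sub0r normrN gtr0_norm; lra.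
apply/negP; rewrite -leNgt subr_le0; apply: off.
by rewrite !mxE/= t1 add0r mulr1; lra.
Qed.

(** * Pairs of polygons without common edge normals *)

(** The direction t lies in the interior of the normal cone of p; in the plane,
    such a t is normal to no edge of the hull of A. *)
Definition unique_max (R : realType) (n : nat) (A : seq 'rV[R]_n)
    (t p : 'rV[R]_n) : Prop :=
  p \in A /\ forall u, u \in A -> u != p -> dotp u t < dotp p t.

Lemma unique_max_near (R : realType) (n : nat) (A : seq 'rV[R]_n)
    (t p d : 'rV[R]_n) :
  unique_max A t p ->
  exists2 r, 0 < r &
    forall s, `|s| < r -> suppf A (t + s *: d) = dotp p (t + s *: d).
Proof.
move=> [pA pmax].
suff [r r0 rA] : exists2 r, 0 < r & forall s, `|s| < r ->
    forall u, u \in A -> dotp u (t + s *: d) <= dotp p (t + s *: d).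
  exists r => // s sr; apply/le_anti/andP; split; last exact: suppf_ge.
  have A0 : A != [::] by case: (A) pA.
  by have [u uA ->] := suppf_attained (t + s *: d) A0; exact: rA.
elim: A {pA} pmax => [|a A IH] pmax; first by exists 1.
have [|r r0 rA] := IH; first by move=> u uA; apply: pmax; rewrite inE uA orbT.
have [->|ap] := eqVneq a p.
  by exists r => // s sr u; rewrite inE => /predU1P[->//|]; exact: rA.
have gap := pmax a (mem_head _ _) ap.
pose c := `|dotp a d - dotp p d| + 1.
have c0 : 0 < c by rewrite ltr_wpDl.
pose e := (dotp p t - dotp a t) / c.
have e0 : 0 < e by rewrite divr_gt0// subr_gt0.
exists (Num.min r e); first by rewrite lt_min r0.
move=> s; rewrite lt_min => /andP[sr se] u; rewrite inE => /predU1P[->|]; last exact: rA.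
rewrite !(dotpDr, dotpZr).
have : s * (dotp a d - dotp p d) <= e * c.
  apply: le_trans (ler_norm _) _; rewrite normrM ler_pM//; first exact: ltW.
  by rewrite lerDl.
by rewrite /e divfK ?gt_eqF//; lra.
Qed.

(** Near t the support function of A is linear, so subtracting it keeps the
    convexity of the support function of F. *)
Lemma locally_supported_suppfB (R : realType) (n : nat) (F A : seq 'rV[R]_n)
    (t p : 'rV[R]_n) :
  F != [::] -> unique_max A t p ->
  locally_supported (fun t => suppf F t - suppf A t) t.
Proof.
move=> F0 pmax; have [q qF qE] := suppf_attained t F0.
have near d := unique_max_near d pmax.
exists (q - p).
  have [r r0 /(_ 0)] := near 0.
  by rewrite normr0 scale0r addr0 dotpBl qE => ->.
move=> d; have [r r0 rE] := near d; exists r => // s sr.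
by rewrite dotpBl rE// lerB// suppf_ge.
Qed.

(** Polygons A and B without common edge normals form the least
    representation of the difference of their support functions, up to a
    simultaneous translation.  Near each direction one of the two
    expressions of k = h_F - h_A = h_G - h_B subtracts a linear function. *)
Theorem no_common_normal_minimal (R : realType) (A B F G : seq 'rV[R]_2) :
  A != [::] -> B != [::] -> F != [::] -> G != [::] ->
  (forall t, t != 0 -> (exists p, unique_max A t p) \/ (exists p, unique_max B t p)) ->
  (forall t, suppf F t - suppf G t = suppf A t - suppf B t) ->
  exists v, (forall u, u \in A -> conv_hull [set x | x \in F] (u + v)) /\
            (forall u, u \in B -> conv_hull [set x | x \in G] (u + v)).
Proof.
move=> A0 B0 F0 G0 AB FG.
have kE : (fun t => suppf F t - suppf A t) = (fun t => suppf G t - suppf B t).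
  by apply/funext => t; have := FG t; lra.
have [||v vk] := @linear_minorant R (fun t => suppf F t - suppf A t).
- move=> t; exact: (continuousB (@suppf_continuous R 2 F t) (@suppf_continuous R 2 A t)).
- move=> t /AB[[p]|[p]] pmax; first exact: (locally_supported_suppfB _ pmax).
  by rewrite kE; exact: (locally_supported_suppfB _ pmax).
exists v; split => u uA; apply: separation_suppf => // t; rewrite dotpDl.
  by have := vk t; have := suppf_ge t uA; lra.
have := congr1 (fun k => k t) kE.
by have := vk t; have := suppf_ge t uA; rewrite /=; lra.
Qed.

(** * Growth of tropical rational functions at infinity *)

Lemma suppfZ (R : realType) (n : nat) (S : seq 'rV[R]_n) (a : R) (t : 'rV[R]_n) :
  0 <= a -> suppf S (a *: t) = a * suppf S t.
Proof.
have [->|S0] := eqVneq S [::].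
  by rewrite /suppf !big_nil dotpZr.
move=> a0; apply/le_anti/andP; split.
  have [u uS ->] := suppf_attained (a *: t) S0.
  by rewrite dotpZr ler_wpM2l// suppf_ge.
have [u uS ->] := suppf_attained t S0.
by rewrite -dotpZr suppf_ge.
Qed.

(** The points whose convex hull is the Newton polytope of f. *)
Definition exps (R : realType) (n : nat) (f : tpoly R n) : seq 'rV[R]_n :=
  [seq real_exp R i | i <- finsupp f].

Lemma tpoly_eval_leP (R : realType) (n : nat) (f : tpoly R n) (t : 'rV[R]_n)
    (M : \bar R) :
  (tpoly_eval f t <= M)%E <->
  forall i, (trop_ereal (f i) + (dotp (real_exp R i) t)%:E <= M)%E.
Proof.
split=> [fM i|fM].
  have [fi|fi] := boolP (i \in finsupp f).
    apply: le_trans fM.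
    exact: (@le_bigmax_seq _ _ _ _ _ i xpredT
      (fun i => trop_ereal (f i) + (dotp (real_exp R i) t)%:E)%E).
  by rewrite fsfun_dflt//= leNye.
by apply: (big_ind (fun x => (x <= M)%E)) => [|x y xM yM|i _];
  [exact: leNye|rewrite ge_max xM|exact: fM].
Qed.

Lemma tpoly_neq_ninfty (R : realType) (n : nat) (f : tpoly R n) :
  f <> tpoly_ninfty R n -> exps f != [::].
Proof.
move=> f0; apply/eqP => fE; apply: f0; apply/fsfunP => i.
rewrite fsfun0E /= ; apply: fsfun_dflt; apply/negP => fi.
have : real_exp R i \in exps f by apply: map_f.
by rewrite fE.
Qed.

(** The coefficients move the value by a bounded amount only. *)
Lemma tpoly_eval_suppf (R : realType) (n : nat) (f : tpoly R n) :
  exps f != [::] -> exists C, forall t, exists2 e,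
    tpoly_eval f t = e%:E & `|e - suppf (exps f) t| <= C.
Proof.
move=> f0.
pose c i := fine (trop_ereal (f i)).
have fc i : i \in finsupp f -> trop_ereal (f i) = (c i)%:E.
  by rewrite mem_finsupp /c; case: (f i).
pose C := \sum_(i <- finsupp f) `|c i|.
have cC i : i \in finsupp f -> `|c i| <= C.
  by move=> fi; rewrite /C (big_rem i)//= lerDl sumr_ge0.
exists C => t.
have up : (tpoly_eval f t <= (suppf (exps f) t + C)%:E)%E.
  apply/tpoly_eval_leP => i.
  have [fi|fi] := boolP (i \in finsupp f); last by rewrite fsfun_dflt//= leNye.
  rewrite fc// -EFinD lee_fin addrC lerD//; first by apply: suppf_ge; exact: map_f.
  exact: le_trans (ler_norm _) (cC _ fi).
have lo : ((suppf (exps f) t - C)%:E <= tpoly_eval f t)%E.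
  have [_ /mapP[i fi ->] ->] := suppf_attained t f0.
  apply: le_trans ((tpoly_eval_leP f t _).1 (lexx _) i).
  rewrite fc// -EFinD lee_fin addrC lerD2r lerNl.
  by apply: le_trans (cC _ fi); rewrite -normrN ler_norm.
move: up lo; case: (tpoly_eval f t) => [e||]; rewrite ?lee_fin//= => up lo.
by exists e => //; rewrite ler_norml; apply/andP; split; lra.
Qed.

(** Support functions are homogeneous of degree 1, while by [tpoly_eval_suppf]
    both sides differ by a bounded function. *)
Lemma trop_quot_recession (R : realType) (n : nat) (f g f' g' : tpoly R n) :
  exps f != [::] -> exps g != [::] -> exps f' != [::] -> exps g' != [::] ->
  trop_quot f g = trop_quot f' g' ->
  forall t, suppf (exps f) t - suppf (exps g) t =
            suppf (exps f') t - suppf (exps g') t.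
Proof.
move=> /tpoly_eval_suppf[C1 H1] /tpoly_eval_suppf[C2 H2].
move=> /tpoly_eval_suppf[C3 H3] /tpoly_eval_suppf[C4 H4] FG t.
set x1 := suppf (exps f) t; set x2 := suppf (exps g) t.
set x3 := suppf (exps f') t; set x4 := suppf (exps g') t.
pose D := (x1 - x2) - (x3 - x4).
pose K := C1 + C2 + C3 + C4.
have DK (l : R) : 0 <= l -> `|l * D| <= K.
  move=> l0.
  have [e1 E1 B1] := H1 (l *: t); have [e2 E2 B2] := H2 (l *: t).
  have [e3 E3 B3] := H3 (l *: t); have [e4 E4 B4] := H4 (l *: t).
  have := congr1 (fun phi => phi (l *: t)) FG.
  rewrite /trop_quot E1 E2 E3 E4 -!EFinB => -[ee].
  move: B1 B2 B3 B4; rewrite !suppfZ// -/x1 -/x2 -/x3 -/x4 !ler_norml.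
  move=> /andP[? ?] /andP[? ?] /andP[? ?] /andP[? ?].
  by rewrite /D /K; apply/andP; split; lra.
have K0 : 0 <= K by have := DK 0 (lexx _); rewrite mul0r normr0.
suff : D = 0 by rewrite /D; lra.
apply/eqP/negPn/negP => D0.
have nD : 0 < `|D| by rewrite normr_gt0.
(* At this scale a nonzero D would exceed the bound K. *)
have l0 : 0 <= (K + 1) / `|D| by rewrite divr_ge0// ltW// ltr_wpDl.
have := DK _ l0; rewrite normrM ger0_norm// divfK ?gt_eqF//; lra.
Qed.

(** The quotient on the left is finite everywhere, while a numerator without terms
    gives -oo. *)
Lemma trop_quot_ninfty (R : realType) (n : nat) (f g f' g' : tpoly R n) :
  trop_quot f g = trop_quot f' g' -> exps f != [::] -> exps g != [::] ->
  exps g' != [::] -> exps f' != [::].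
Proof.
move=> FG /tpoly_eval_suppf[_ /(_ 0)[e1 E1 _]] /tpoly_eval_suppf[_ /(_ 0)[e2 E2 _]].
move=> /tpoly_eval_suppf[_ /(_ 0)[e3 E3 _]]; apply/eqP => f0.
have fs : finsupp f' = fset0.
  apply/fsetP => i; rewrite in_fset0; apply/negP => fi.
  have : real_exp R i \in exps f' by exact: map_f.
  by rewrite f0.
have := congr1 (fun phi => phi 0) FG.
by rewrite /trop_quot E1 E2 E3 /tpoly_eval fs big_nil.
Qed.

(** * The Newton polytope of a pair *)

Lemma tpoly_addE (R : realType) (n : nat) (f g : tpoly R n) (i : 'rV[int]_n) :
  tpoly_add f g i = trop_add (f i) (g i).
Proof.
rewrite /tpoly_add fsfunE in_fsetU; case: ifPn => //.
by rewrite negb_or => /andP[? ?]; rewrite !fsfun_dflt.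
Qed.

Lemma tpoly_liftE (R : realType) (n : nat) (f : tpoly R n) (j : 'rV[int]_n) (z : int) :
  tpoly_lift f (row_mx j (const_mx z)) = if z == 0 then f j else None.
Proof.
rewrite /tpoly_lift fsfunE row_mxKl; case: ifPn => [/imfsetP[k /= fk jk]|nf].
  have [-> z0] := eq_row_mx jk.
  by move/matrixP/(_ 0 0): z0; rewrite !mxE => ->; rewrite eqxx.
case: eqVneq => // z0; rewrite fsfun_dflt//; apply: contra nf => fj.
apply/imfsetP; exists j => //=; rewrite z0; congr row_mx.
Qed.

Lemma tpoly_mul_varE (R : realType) (n : nat) (k : 'I_n) (g : tpoly R n)
    (i : 'rV[int]_n) :
  tpoly_mul (tpoly_var R k) g i = g (i - delta_mx 0 k).
Proof.
have varE : finsupp (tpoly_var R k) = [fset delta_mx 0 k]%fset.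
  apply/fsetP => j; rewrite mem_finsupp /tpoly_var fsfunE !in_fset1.
  by case: (j == _).
rewrite /tpoly_mul fsfunE; case: ifPn => [_|nf].
  rewrite varE big_seq_fset1 /tpoly_var fsfunE in_fset1 eqxx /=.
  by case: (g _) => [a|]//=; rewrite add0r.
apply/esym/fsfun_dflt; apply: contra nf => gi.
apply/imfset2P; exists (delta_mx 0 k); first by rewrite /= varE in_fset1.
by exists (i - delta_mx 0 k) => //=; rewrite subrKC.
Qed.

(** The two summands live on different heights of the last exponent, so nothing
    cancels or merges. *)
Lemma tpoly_pairE (R : realType) (n : nat) (f g : tpoly R n) (j : 'rV[int]_n) (z : int) :
  tpoly_pair f g (row_mx j (const_mx z)) =
  if z == 0 then f j else if z == 1 then g j else None.
Proof.
rewrite /tpoly_pair tpoly_addE tpoly_mul_varE tpoly_liftE.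
have -> : row_mx j (const_mx z) - delta_mx 0 (rshift n ord0) =
    row_mx j (const_mx (z - 1)) :> 'rV[int]_(n + 1).
  have -> : delta_mx 0 (rshift n ord0) = row_mx 0 (const_mx 1) :> 'rV[int]_(n + 1).
    apply/rowP => a; rewrite !mxE; case: splitP => b ab; rewrite !mxE.
      rewrite (_ : (a == _) = false) ?andbF//; apply/eqP => /(congr1 val) /= e.
      by have := ltn_ord b; rewrite -ab e addn0 ltnn.
    by rewrite (_ : (a == _) = true)//; apply/eqP/val_inj; rewrite /= ab (ord1 b).
  rewrite opp_row_mx add_row_mx oppr0 addr0; congr row_mx.
  by apply/matrixP => a b; rewrite !mxE.
rewrite tpoly_liftE subr_eq0; case: eqVneq => [->|] /=; last by case: eqVneq.
by case: (f j).
Qed.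

Lemma tpoly_pair_supp (R : realType) (n : nat) (f g : tpoly R n) (P : 'rV[int]_(n + 1) -> Prop) :
  (forall j, f j <> None -> P (row_mx j (const_mx 0))) ->
  (forall j, g j <> None -> P (row_mx j (const_mx 1))) ->
  forall i, tpoly_pair f g i <> None -> P i.
Proof.
move=> Pf Pg i.
have -> : i = row_mx (lsubmx i) (const_mx (i 0 (rshift n ord0))).
  rewrite -{1}(hsubmxK i); congr row_mx; apply/matrixP => a b.
  by rewrite !mxE (ord1 a) (ord1 b).
move: (lsubmx i) (i _ _) => j z.
rewrite tpoly_pairE; case: eqVneq => [->|_]; first exact: Pf.
by case: eqVneq => [->|_]; first exact: Pg.
Qed.

Lemma real_exp_row (R : realType) (n : nat) (j : 'rV[int]_n) (z : int) :
  real_exp R (row_mx j (const_mx z : 'rV_1)) = row_mx (real_exp R j) (const_mx z%:~R).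
Proof. by rewrite /real_exp map_row_mx map_const_mx. Qed.

Lemma newt_pair_bot (R : realType) (n : nat) (f g : tpoly R n) (u : 'rV[R]_n) :
  conv_hull [set x | x \in exps f] u ->
  newt (tpoly_pair f g) (row_mx u (const_mx 0)).
Proof.
apply: (@conv_hull_min R n _ [set u | newt (tpoly_pair f g) (row_mx u (const_mx 0))]).
  apply/convex_setP => x y t t0 t1 /= Ax Ay.
  have := (convex_setP _).1 (@conv_hull_convex _ _ _) _ _ _ t0 t1 Ax Ay.
  rewrite !scale_row_mx add_row_mx; congr (conv_hull _ (row_mx _ _)).
  by apply/matrixP => a b; rewrite !mxE !mulr0 addr0.
move=> _ /= /mapP[j fj ->]; apply: sub_conv_hull.
exists (row_mx j (const_mx 0)); last by rewrite real_exp_row.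
by rewrite /= tpoly_pairE eqxx; apply/eqP; rewrite -mem_finsupp.
Qed.

Lemma newt_pair_top (R : realType) (n : nat) (f g : tpoly R n) (u : 'rV[R]_n) :
  conv_hull [set x | x \in exps g] u ->
  newt (tpoly_pair f g) (row_mx u (const_mx 1)).
Proof.
apply: (@conv_hull_min R n _ [set u | newt (tpoly_pair f g) (row_mx u (const_mx 1))]).
  apply/convex_setP => x y t t0 t1 /= Ax Ay.
  have := (convex_setP _).1 (@conv_hull_convex _ _ _) _ _ _ t0 t1 Ax Ay.
  rewrite !scale_row_mx add_row_mx; congr (conv_hull _ (row_mx _ _)).
  by apply/matrixP => a b; rewrite !mxE; ring.
move=> _ /= /mapP[j fj ->]; apply: sub_conv_hull.
exists (row_mx j (const_mx 1)); last by rewrite real_exp_row.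
by rewrite /= tpoly_pairE; apply/eqP; rewrite -mem_finsupp.
Qed.

Lemma newt_pair_min (R : realType) (n : nat) (f g : tpoly R n) (C : set 'rV[R]_(n + 1)) :
  @convex_set R 'rV[R]_(n + 1) C ->
  (forall u, u \in exps f -> C (row_mx u (const_mx 0))) ->
  (forall u, u \in exps g -> C (row_mx u (const_mx 1))) ->
  newt (tpoly_pair f g) `<=` C.
Proof.
move=> cC Cf Cg; apply: conv_hull_min => // _ [i fi <-].
move: i fi; apply: tpoly_pair_supp => j fj; rewrite real_exp_row.
  by apply: Cf; apply: map_f; rewrite mem_finsupp; apply/eqP.
by apply: Cg; apply: map_f; rewrite mem_finsupp; apply/eqP.
Qed.

Lemma newt_pair_translate (R : realType) (n : nat) (f g f' g' : tpoly R n) (v : 'rV[R]_n) :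
  (forall u, u \in exps f -> conv_hull [set x | x \in exps f'] (u + v)) ->
  (forall u, u \in exps g -> conv_hull [set x | x \in exps g'] (u + v)) ->
  forall x, newt (tpoly_pair f g) x ->
    newt (tpoly_pair f' g') (x + row_mx v (const_mx 0)).
Proof.
move=> Hf Hg; apply: newt_pair_min.
- apply/convex_setP => x y t t0 t1 /= Ax Ay.
  have := (convex_setP _).1 (@conv_hull_convex _ _ _) _ _ _ t0 t1 Ax Ay.
  by congr (conv_hull _ _); apply/matrixP => a b; rewrite !mxE; ring.
- move=> u /Hf /newt_pair_bot; rewrite add_row_mx => /(_ g').
  by congr (newt _ (row_mx _ _)); apply/matrixP => a b; rewrite !mxE addr0.
- move=> u /Hg /newt_pair_top; rewrite add_row_mx => /(_ f').
  by congr (newt _ (row_mx _ _)); apply/matrixP => a b; rewrite !mxE addr0.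
Qed.

(** Affine combinations with real coefficients make the translations that keep p
    in the span into a linear subspace, which contains all the basis vectors. *)
Lemma affine_span_dim_full (R : realType) (n : nat) (A : set 'rV[R]_n)
    (p : 'rV[R]_n) (e : R) :
  e != 0 -> A p -> (forall i, A (p + e *: delta_mx 0 i)) -> affine_span_dim A n.
Proof.
move=> e0 Ap Ai; exists 0, fullv; split; last by rewrite dimvf /dim /= mul1n.
apply/seteqP; split => x _; first by exists x; [exact: memvf|rewrite add0r].
move=> B [aB AB].
pose L u := B (p + u).
have LZ c u : L u -> L (c *: u).
  move=> Lu; have := aB _ _ c Lu (AB _ Ap).
  by congr B; apply/rowP => i; rewrite !mxE; ring.
have LD u w : L u -> L w -> L (u + w).
  move=> Lu Lw; have := aB _ _ (2^-1) Lu Lw.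
  have -> : 2^-1 *: (p + u) + (1 - 2^-1) *: (p + w) = p + 2^-1 *: (u + w).
    by apply/rowP => i; rewrite !mxE; field.
  by move=> /(LZ 2); rewrite scalerA divff ?scale1r// pnatr_eq0.
have -> : x = p + (x - p) by rewrite subrKC.
rewrite -/(L _) (row_sum_delta (x - p)); apply: (big_ind L) => //.
  by rewrite /L addr0; exact: AB.
move=> i _; have -> : (x - p) 0 i *: delta_mx 0 i =
    ((x - p) 0 i / e) *: (e *: delta_mx 0 i) :> 'rV[R]_n by rewrite scalerA divfK.
by apply: LZ; exact: AB.
Qed.

(** * Cells of the dual subdivision *)

(** A linear form that attains its maximum on a convex hull attains it at a
    generator. *)
Lemma dual_cell_exponent (R : realType) (n : nat) (h : tpoly R n) (C : set 'rV[R]_n) :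
  dual_subdivision h C -> exists2 i, h i <> None & C (real_exp R i).
Proof.
move=> [F [[[p Fp] [u FE]] _] <-].
apply: contrapT => no.
have [Pp maxp] : upper_newt h p /\ forall q, upper_newt h q -> dotp u q <= dotp u p.
  by move: Fp; rewrite FE.
suff : upper_newt h `<=` [set q | dotp u q < dotp u p].
  by move=> /(_ _ Pp) /=; rewrite ltxx.
apply: conv_hull_min.
  apply/convex_setP => x y t t0 t1 /= xp yp; rewrite dotpDr !dotpZr.
  have [->|tn] := eqVneq t 0; first by rewrite mul0r add0r subr0 mul1r.
  have tpos : 0 < t by rewrite lt_neqAle eq_sym tn.
  have : t * dotp u x < t * dotp u p by rewrite ltr_pM2l.
  have : (1 - t) * dotp u y <= (1 - t) * dotp u p.
    by rewrite ler_wpM2l ?subr_ge0// ltW.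
  lra.
move=> q Gq; have Pq : upper_newt h q by exact: sub_conv_hull.
rewrite /= lt_neqAle maxp// andbT; apply/eqP => qp; apply: no.
case: Gq => i [a [ai qE]]; exists i; first by move=> hi; move: ai; rewrite hi.
exists q; last by rewrite qE row_mxKl.
by rewrite FE; split=> // q' /maxp; rewrite qp.
Qed.

Lemma dotp_row_mx (R : realType) (n m : nat) (a b : 'rV[R]_n) (c d : 'rV[R]_m) :
  dotp (row_mx a c) (row_mx b d) = dotp a b + dotp c d.
Proof.
rewrite /dotp big_split_ord /=; congr (_ + _); apply: eq_bigr => i _.
  by rewrite !row_mxEl.
by rewrite !row_mxEr.
Qed.

(** The form (w, 1) attains its maximum over the upper hull only at (i, c). *)
Lemma dual_vertex (R : realType) (n : nat) (h : tpoly R n) (i : 'rV[int]_n) (c : R)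
    (w : 'rV[R]_n) :
  h i = Some c ->
  (forall j b, j != i -> h j = Some b ->
     dotp (real_exp R j) w + b < dotp (real_exp R i) w + c) ->
  dual_subdivision h [set real_exp R i].
Proof.
move=> hi imax.
pose p : 'rV[R]_(n + 1) := row_mx (real_exp R i) (const_mx c).
pose u : 'rV[R]_(n + 1) := row_mx w (const_mx 1).
have uE j a : dotp u (row_mx (real_exp R j) (const_mx a)) = dotp (real_exp R j) w + a.
  by rewrite dotp_row_mx dotpC; congr (_ + _); rewrite /dotp big_ord1 !mxE mul1r.
have Pp : upper_newt h p by apply: sub_conv_hull; exists i, c; rewrite hi lexx.
have Psub : upper_newt h `<=` [set q | q = p \/ dotp u q < dotp u p].
  apply: conv_hull_min.
    apply/convex_setP => x y t t0 t1.
    have [->|tn0] := eqVneq t 0; first by rewrite scale0r add0r subr0 scale1r.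
    have [->|tn1] := eqVneq t 1; first by rewrite subrr scale0r addr0 scale1r.
    have tp : 0 < t by rewrite lt_neqAle eq_sym tn0.
    have tp1 : 0 < 1 - t by rewrite subr_gt0 lt_neqAle tn1.
    move=> /= [->|xp] [->|yp]; rewrite ?dotpDr ?dotpZr.
    - by left; rewrite -scalerDl subrKC scale1r.
    - have : (1 - t) * dotp u y < (1 - t) * dotp u p by rewrite ltr_pM2l.
      by right; lra.
    - have : t * dotp u x < t * dotp u p by rewrite ltr_pM2l.
      by right; lra.
    - have : (1 - t) * dotp u y < (1 - t) * dotp u p by rewrite ltr_pM2l.
      have : t * dotp u x < t * dotp u p by rewrite ltr_pM2l.
      by right; lra.
  move=> q [j [a [aj ->]]] /=; rewrite !uE.
  have [ji|ji] := eqVneq j i.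
    move: aj; rewrite ji hi lee_fin le_eqVlt => /predU1P[->|ac]; first by left.
    by right; rewrite ltrD2l.
  case hj : (h j) aj => [b|//]; rewrite lee_fin => ab; right.
  by apply: le_lt_trans (imax _ _ ji hj); rewrite lerD2l.
exists [set p]; last by rewrite image_set1 row_mxKl.
split; last first.
  exact: (compact_bounded (@compact_set1 _ p)).
split; first by exists p.
exists u; apply/seteqP; split => q /=.
  by move=> ->; split => // q' /Psub[->//|/ltW].
by move=> [/Psub[//|qp] /(_ _ Pp)]; rewrite leNgt qp.
Qed.

(** * The two expressions *)

Definition ipt (a b : int) : 'rV[int]_2 := \row_k [:: a; b]`_k.

(** Exponents of F, with coefficient 0. *)
Definition tri : {fset 'rV[int]_2} := [fset ipt 1 0; ipt 0 1; ipt (-1) (-1)]%fset.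

(** The remaining vertices of the hexagon, with coefficient -1. *)
Definition outer : {fset 'rV[int]_2} := [fset ipt 1 1; ipt (-1) 0; ipt 0 (-1)]%fset.

(** One coefficient function serves all four polynomials, which then differ only
    in their sets of exponents. *)
Definition coef (R : realType) (i : 'rV[int]_2) : R :=
  if i == ipt 0 0 then 1 else if i \in tri then 0 else -1.

Definition poly_on (R : realType) (A : {fset 'rV[int]_2}) : tpoly R 2 :=
  [fsfun i in A => Some (coef R i) | None].

Definition num1 (R : realType) := poly_on R tri.
Definition den1 (R : realType) := poly_on R (tri `|` outer)%fset.
Definition num2 (R : realType) := poly_on R (ipt 0 0 |` tri)%fset.
Definition den2 (R : realType) := poly_on R (ipt 0 0 |` (tri `|` outer))%fset.

Lemma ipt_eq (a b c d : int) : (ipt a b == ipt c d) = (a == c) && (b == d).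
Proof.
apply/eqP/andP => [/rowP h|[/eqP-> /eqP->]//].
by have := h 0; have := h 1; rewrite !mxE/= => -> ->; rewrite !eqxx.
Qed.

Lemma dotp_ipt (R : realType) (a b : int) (t : 'rV[R]_2) :
  dotp (real_exp R (ipt a b)) t = a%:~R * t 0 0 + b%:~R * t 0 1.
Proof.
rewrite /dotp !big_ord_recl big_ord0 addr0 !mxE /=.
by congr (_ + _ * t _ _); apply/val_inj.
Qed.

Lemma poly_onE (R : realType) (A : {fset 'rV[int]_2}) (i : 'rV[int]_2) :
  poly_on R A i = if i \in A then Some (coef R i) else None.
Proof. by rewrite /poly_on fsfunE. Qed.

Lemma mem_exps (R : realType) (A : {fset 'rV[int]_2}) (u : 'rV[R]_2) :
  u \in exps (poly_on R A) <-> exists2 i, i \in A & u = real_exp R i.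
Proof.
split=> [/mapP[i fi ->]|[i iA ->]].
  by exists i => //; move: fi; rewrite mem_finsupp poly_onE; case: ifP.
by apply: map_f; rewrite mem_finsupp poly_onE iA.
Qed.

Local Open Scope ereal_scope.
Lemma eval_poly_onU (R : realType) (A B : {fset 'rV[int]_2}) (t : 'rV[R]_2) :
  tpoly_eval (poly_on R (A `|` B)%fset) t =
  maxe (tpoly_eval (poly_on R A) t) (tpoly_eval (poly_on R B) t).
Proof.
apply/le_anti/andP; split.
  apply/tpoly_eval_leP => i; rewrite poly_onE in_fsetU le_max.
  have [iA|iA]/= := boolP (i \in A).
    have := (tpoly_eval_leP (poly_on R A) t _).1 (lexx _) i.
    by rewrite poly_onE iA => ->.
  have [iB|iB]/= := boolP (i \in B); last by rewrite leNye.
  have := (tpoly_eval_leP (poly_on R B) t _).1 (lexx _) i.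
  by rewrite poly_onE iB => ->; rewrite orbT.
rewrite ge_max; apply/andP; split; apply/tpoly_eval_leP => i; rewrite poly_onE.
  case: ifPn => iA; last by rewrite leNye.
  have := (tpoly_eval_leP (poly_on R (A `|` B)%fset) t _).1 (lexx _) i.
  by rewrite poly_onE in_fsetU iA.
case: ifPn => iA; last by rewrite leNye.
have := (tpoly_eval_leP (poly_on R (A `|` B)%fset) t _).1 (lexx _) i.
by rewrite poly_onE in_fsetU iA orbT.
Qed.

Lemma eval_poly_on1 (R : realType) (i : 'rV[int]_2) (t : 'rV[R]_2) :
  tpoly_eval (poly_on R [fset i]%fset) t = (coef R i + dotp (real_exp R i) t)%:E.
Proof.
apply/le_anti/andP; split.
  apply/tpoly_eval_leP => j; rewrite poly_onE in_fset1.
  by case: eqP => [->|_]; rewrite ?lexx ?leNye.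
have := (tpoly_eval_leP (poly_on R [fset i]%fset) t _).1 (lexx _) i.
by rewrite poly_onE in_fset1 eqxx.
Qed.
Local Close Scope ereal_scope.

(** Where F < 1 the maximum G is F itself, and where 1 <= F the new constant term
    is invisible in both maxima. *)
Lemma same_quotient (R : realType) : trop_quot (num1 R) (den1 R) = trop_quot (num2 R) (den2 R).
Proof.
apply/funext => t; rewrite /trop_quot /num1 /den1 /num2 /den2 /tri /outer.
rewrite !eval_poly_onU !eval_poly_on1 /coef !in_fsetU !in_fset1 !ipt_eq /= !dotp_ipt.
move: (t 0 0) (t 0 1) => x y.
rewrite -!EFin_max -!EFinB; congr EFin.
set F := Num.max (Num.max _ _) _; set L := Num.max (Num.max _ _) _.
set c := (1 + _).
have c1 : c = 1 by rewrite /c; ring.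
have F1 : x <= F by rewrite !le_max; apply/orP; left; apply/orP; left; lra.
have F2 : y <= F by rewrite !le_max; apply/orP; left; apply/orP; right; lra.
have F3 : - x - y <= F by rewrite !le_max; apply/orP; right; lra.
have [F4|F4] := leP 1 F.
  by rewrite c1 (max_r F4) (max_r (_ : 1 <= Num.max F L)) // le_max F4.
(* From x, y <= F < 1 and -x-y <= F: x+y-1 <= y, -x-1 <= -x-y and -y-1 <= -x-y. *)
have LF : L <= F by rewrite !ge_max; apply/andP; split; [apply/andP; split|]; lra.
by rewrite (max_l LF) !subrr.
Qed.

Lemma exps_num1 (R : realType) (u : 'rV[R]_2) : u \in exps (num1 R) <->
  [\/ u = real_exp R (ipt 1 0), u = real_exp R (ipt 0 1) |
      u = real_exp R (ipt (-1) (-1))].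
Proof.
split=> [/mem_exps[i]|].
  rewrite !in_fsetU !in_fset1 => /orP[/orP[]|] /eqP-> ->;
    by [constructor 1|constructor 2|constructor 3].
by case=> ->; apply/mem_exps; eexists; try reflexivity; rewrite !in_fsetU !in_fset1 eqxx ?orbT.
Qed.

Lemma exps_den1 (R : realType) (u : 'rV[R]_2) : u \in exps (den1 R) <->
  u \in exps (num1 R) \/
  [\/ u = real_exp R (ipt 1 1), u = real_exp R (ipt (-1) 0) |
      u = real_exp R (ipt 0 (-1))].
Proof.
split=> [/mem_exps[i]|].
  rewrite in_fsetU => /orP[it ->|]; first by left; apply/mem_exps; exists i.
  rewrite !in_fsetU !in_fset1 => /orP[/orP[]|] /eqP-> ->; right;
    by [constructor 1|constructor 2|constructor 3].
case=> [/mem_exps[i it ->]|].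
  by apply/mem_exps; exists i => //; rewrite in_fsetU it.
by case=> ->; apply/mem_exps; eexists; try reflexivity; rewrite !in_fsetU !in_fset1 eqxx ?orbT.
Qed.

(** The edge normals of the triangle are the rays through (1,1), (1,-2) and
    (-2,1); on them the hexagon has the unique maximizers (1,1), (0,-1) and
    (-1,0). *)
Lemma unique_max_num1_or_den1 (R : realType) (t : 'rV[R]_2) : t != 0 ->
  (exists p, unique_max (exps (num1 R)) t p) \/ (exists p, unique_max (exps (den1 R)) t p).
Proof.
move=> t0.
have xy : t 0 0 != 0 \/ t 0 1 != 0.
  have [x0|] := eqVneq (t 0 0) 0; last by left.
  have [y0|] := eqVneq (t 0 1) 0; last by right.
  case/eqP: t0; apply/rowP => i; rewrite mxE.
  by case: i => [[|[|//]] ?]; [rewrite -x0|rewrite -y0]; congr (t _ _); apply/val_inj.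
have dE a b : dotp (real_exp R (ipt a b)) t = a%:~R * t 0 0 + b%:~R * t 0 1.
  exact: dotp_ipt.
move: xy dE; move: (t 0 0) (t 0 1) => x y xy dE.
have fmax a b : real_exp R (ipt a b) \in exps (num1 R) ->
  [/\ (a, b) != (1, 0) -> x < a%:~R * x + b%:~R * y,
      (a, b) != (0, 1) -> y < a%:~R * x + b%:~R * y &
      (a, b) != (-1, -1) -> - x - y < a%:~R * x + b%:~R * y] ->
  exists p, unique_max (exps (num1 R)) t p.
  move=> pf [m1 m2 m3]; exists (real_exp R (ipt a b)); split=> // u /exps_num1[] ->;
    rewrite !dE => ne.
  - suff : x < a%:~R * x + b%:~R * y by lra.
    by apply: m1; apply: contra ne => /eqP[-> ->].
  - suff : y < a%:~R * x + b%:~R * y by lra.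
    by apply: m2; apply: contra ne => /eqP[-> ->].
  - suff : - x - y < a%:~R * x + b%:~R * y by lra.
    by apply: m3; apply: contra ne => /eqP[-> ->].
have gmax a b : real_exp R (ipt a b) \in exps (den1 R) ->
  [/\ x < a%:~R * x + b%:~R * y, y < a%:~R * x + b%:~R * y &
      - x - y < a%:~R * x + b%:~R * y] ->
  [/\ (a, b) != (1, 1) -> x + y < a%:~R * x + b%:~R * y,
      (a, b) != (-1, 0) -> - x < a%:~R * x + b%:~R * y &
      (a, b) != (0, -1) -> - y < a%:~R * x + b%:~R * y] ->
  exists p, unique_max (exps (den1 R)) t p.
  move=> pf [l1 l2 l3] [m1 m2 m3]; exists (real_exp R (ipt a b)); split=> // u.
  move=> /exps_den1[/exps_num1|][] ->; rewrite !dE => ne; try lra.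
  - suff : x + y < a%:~R * x + b%:~R * y by lra.
    by apply: m1; apply: contra ne => /eqP[-> ->].
  - suff : - x < a%:~R * x + b%:~R * y by lra.
    by apply: m2; apply: contra ne => /eqP[-> ->].
  - suff : - y < a%:~R * x + b%:~R * y by lra.
    by apply: m3; apply: contra ne => /eqP[-> ->].
have F1 : real_exp R (ipt 1 0) \in exps (num1 R) by apply/exps_num1; constructor 1.
have F2 : real_exp R (ipt 0 1) \in exps (num1 R) by apply/exps_num1; constructor 2.
have F3 : real_exp R (ipt (-1) (-1)) \in exps (num1 R) by apply/exps_num1; constructor 3.
have G1 : real_exp R (ipt 1 1) \in exps (den1 R) by apply/exps_den1; right; constructor 1.
have G2 : real_exp R (ipt (-1) 0) \in exps (den1 R) by apply/exps_den1; right; constructor 2.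
have G3 : real_exp R (ipt 0 (-1)) \in exps (den1 R) by apply/exps_den1; right; constructor 3.
have xy' : [\/ x < 0, 0 < x, y < 0 | 0 < y].
  by case: xy; rewrite neq_lt => /orP[];
    [constructor 1|constructor 2|constructor 3|constructor 4].
clear dE xy.
have [xy|xy|xy] := ltgtP x y.
- have [yz|yz|yz] := ltgtP y (- x - y).
  + by left; apply: (fmax _ _ F3); split=> // _; lra.
  + by left; apply: (fmax _ _ F2); split=> // _; lra.
  + by right; apply: (gmax _ _ G2); split=> // *; lra.
- have [xz|xz|xz] := ltgtP x (- x - y).
  + by left; apply: (fmax _ _ F3); split=> // _; lra.
  + by left; apply: (fmax _ _ F1); split=> // _; lra.
  + by right; apply: (gmax _ _ G3); split=> // *; lra.
- have [xz|xz|xz] := ltgtP x (- x - y).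
  + by left; apply: (fmax _ _ F3); split=> // _; lra.
  + by right; apply: (gmax _ _ G1); split=> // *; lra.
  + by case: xy'; lra.
Qed.

Definition rpt (R : realType) (x y : R) : 'rV[R]_2 := \row_k [:: x; y]`_k.

Lemma rpt_eta (R : realType) (u : 'rV[R]_2) : u = rpt (u 0 0) (u 0 1).
Proof.
apply/rowP => i; rewrite !mxE.
by case: i => [[|[|//]] ?] /=; congr (u _ _); apply/val_inj.
Qed.

Lemma real_exp_ipt (R : realType) (a b : int) :
  real_exp R (ipt a b) = rpt a%:~R b%:~R.
Proof. by apply/rowP => i; rewrite !mxE; case: i => [[|[|//]] ?]. Qed.

Lemma row_mx_rpt (R : realType) (x y z : R) :
  row_mx (rpt x y) (const_mx z) = row3 x y z :> 'rV[R]_(2 + 1).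
Proof.
apply/rowP => i; rewrite !mxE; case: splitP => j ij; rewrite !mxE ij.
  by case: j {ij} => [[|[|//]] ?].
by rewrite (ord1 j).
Qed.

(** Barycentric coordinates in the triangle. *)
Lemma num1_hull (R : realType) (x y : R) :
  0 <= x <= 1 / 4 -> 0 <= y <= 1 / 4 ->
  conv_hull [set u | u \in exps (num1 R)] (rpt x y).
Proof.
move=> /andP[x0 x1] /andP[y0 y1].
pose c := (1 - x - y) / 3.
have c0 : 0 <= c by rewrite /c; lra.
have -> : rpt x y = \sum_(i < 3) [:: x + c; y + c; c]`_i *:
    [:: real_exp R (ipt 1 0); real_exp R (ipt 0 1); real_exp R (ipt (-1) (-1))]`_i.
  rewrite !big_ord_recl big_ord0 /= !real_exp_ipt.
  apply/rowP => i; rewrite !mxE.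
  by case: i => [[|[|//]] ?] /=; rewrite /c; field.
apply: (@convex_sum R 2 (conv_hull [set u | u \in exps (num1 R)]) 3
  (fun i => [:: x + c; y + c; c]`_i)
  (fun i =>
  [:: real_exp R (ipt 1 0); real_exp R (ipt 0 1); real_exp R (ipt (-1) (-1))]`_i)).
- exact: conv_hull_convex.
- by case=> [[|[|[|//]]] ?] //=; lra.
- by rewrite !big_ord_recl big_ord0 /= /c; field.
- case=> [[|[|[|//]]] ?] /=; apply: sub_conv_hull; apply/exps_num1;
    by [constructor 1|constructor 2|constructor 3].
Qed.

Lemma exps_num1_den1 (R : realType) (u : 'rV[R]_2) : u \in exps (num1 R) -> u \in exps (den1 R).
Proof. by move=> uf; apply/exps_den1; left. Qed.

Lemma den1_hull (R : realType) (x y : R) :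
  0 <= x <= 1 / 4 -> 0 <= y <= 1 / 4 ->
  conv_hull [set u | u \in exps (den1 R)] (rpt x y).
Proof.
move=> hx hy; have := num1_hull hx hy; apply: conv_hull_min; first exact: conv_hull_convex.
by move=> u uf; apply: sub_conv_hull; exact: exps_num1_den1.
Qed.

Lemma newt_pair1_box (R : realType) (x y z : R) :
  0 <= x <= 1 / 4 -> 0 <= y <= 1 / 4 -> 0 <= z <= 1 / 4 ->
  newt (tpoly_pair (num1 R) (den1 R)) (row3 x y z).
Proof.
move=> hx hy /andP[z0 z1].
have := @newt_pair_bot R 2 (num1 R) (den1 R) _ (num1_hull hx hy).
have := @newt_pair_top R 2 (num1 R) (den1 R) _ (den1_hull hx hy).
rewrite !row_mx_rpt => At Ab.
have z1' : z <= 1 by lra.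
have := (convex_setP _).1 (@conv_hull_convex _ _ _) _ _ _ z0 z1' At Ab.
rewrite !row3Z row3D; congr (conv_hull _ (row3 _ _ _)); ring.
Qed.

Lemma zero_or_quarter (R : realType) (x : R) :
  x = 0 \/ x = 1 / 4 -> 0 <= x <= 1 / 4.
Proof. by move=> [->|->]; apply/andP; split; lra. Qed.

Lemma same_newt (R : realType) :
  newt (tpoly_pair (num1 R) (den1 R)) = newt (tpoly_pair (num2 R) (den2 R)).
Proof.
have h4 := zero_or_quarter (or_introl (erefl (0 : R))).
have o0 : real_exp R (ipt 0 0) = rpt 0 0 by rewrite real_exp_ipt.
apply/seteqP; split.
  apply: newt_pair_min; first exact: conv_hull_convex.
    move=> u /mem_exps[i iA ->]; apply: newt_pair_bot; apply: sub_conv_hull.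
    by apply/mem_exps; exists i => //; rewrite in_fsetU iA orbT.
  move=> u /mem_exps[i iA ->]; apply: newt_pair_top; apply: sub_conv_hull.
  by apply/mem_exps; exists i => //; rewrite in_fsetU iA orbT.
apply: newt_pair_min; first exact: conv_hull_convex.
  move=> u /mem_exps[i]; rewrite in_fsetU in_fset1 => /orP[/eqP->|iA] ->.
    by apply: newt_pair_bot; rewrite o0; exact: num1_hull.
  by apply: newt_pair_bot; apply: sub_conv_hull; apply/mem_exps; exists i.
move=> u /mem_exps[i]; rewrite in_fsetU in_fset1 => /orP[/eqP->|iA] ->.
  by apply: newt_pair_top; rewrite o0; exact: den1_hull.
by apply: newt_pair_top; apply: sub_conv_hull; apply/mem_exps; exists i.
Qed.

Lemma row3_delta (R : realType) (e : R) (i : 'I_3) :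
  e *: delta_mx 0 i = row3 (if i == 0 then e else 0) (if i == 1 then e else 0)
    (if i == 2%:R then e else 0).
Proof.
apply/rowP => j; rewrite !mxE /=.
by case: i => [[|[|[|//]]] ?]; case: j => [[|[|[|//]]] ?]; rewrite /= ?mulr1 ?mulr0.
Qed.

(** The box of [newt_pair1_box] spans space. *)
Lemma newt_translate_full (R : realType) (B : set 'rV[R]_3) (v : 'rV[R]_3) :
  (forall x, newt (tpoly_pair (num1 R) (den1 R)) x -> B (x + v)) ->
  affine_span_dim B 3.
Proof.
move=> AB.
have box (x y z : R) : 0 <= x <= 1 / 4 -> 0 <= y <= 1 / 4 -> 0 <= z <= 1 / 4 ->
  B (v + row3 x y z).
  by move=> hx hy hz; rewrite addrC; apply: AB; exact: newt_pair1_box.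
have q0 := zero_or_quarter (or_introl (erefl (0 : R))).
have q4 := zero_or_quarter (or_intror (erefl (1 / 4 : R))).
have z3 : row3 0 0 0 = 0 :> 'rV[R]_3.
  by apply/rowP => i; rewrite !mxE; case: i => [[|[|[|//]]] ?].
apply: (@affine_span_dim_full R 3 B v (1 / 4)).
- by rewrite gt_eqF//; lra.
- by have := box 0 0 0 q0 q0 q0; rewrite z3 addr0.
- by move=> i; rewrite row3_delta; apply: box; case: ifP.
Qed.

Lemma vol_fullE (R : realType) (f g : tpoly R 2) :
  affine_span_dim (newt (tpoly_pair f g)) 3 ->
  vol f g = volume3 (newt (tpoly_pair f g)).
Proof. by move=> fd; rewrite /vol asboolT. Qed.

Lemma vol_pair1E (R : realType) :
  vol (num1 R) (den1 R) = volume3 (newt (tpoly_pair (num1 R) (den1 R))).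
Proof.
by apply: vol_fullE; apply: (@newt_translate_full R _ 0) => x; rewrite addr0.
Qed.

(** The polytope of (f, g) contains a translate of the polytope of the first pair, by
    [no_common_normal_minimal]; in particular it is full-dimensional, so its volume
    is the one that counts. *)
Lemma vol_minimal (R : realType) (f g : tpoly R 2) :
  g <> tpoly_ninfty R 2 -> trop_quot (num1 R) (den1 R) = trop_quot f g ->
  (vol (num1 R) (den1 R) <= vol f g)%E.
Proof.
move=> /tpoly_neq_ninfty g0 FG.
have f10 : exps (num1 R) != [::].
  apply/eqP => e; have /exps_num1 : [\/ real_exp R (ipt 1 0) = real_exp R (ipt 1 0),
   real_exp R (ipt 1 0) = real_exp R (ipt 0 1) | real_exp R (ipt 1 0) = real_exp R (ipt (-1) (-1))].
    by constructor 1.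
  by rewrite e.
have g10 : exps (den1 R) != [::].
  apply/eqP => e; case: (exps (num1 R)) f10 (@exps_num1_den1 R) => // a s _ /(_ a (mem_head _ _)).
  by rewrite e.
have f0 := trop_quot_ninfty FG f10 g10 g0.
have rec t := esym (trop_quot_recession f10 g10 f0 g0 FG t).
have [v [vf vg]] := no_common_normal_minimal f10 g10 f0 g0 (@unique_max_num1_or_den1 R) rec.
have tr := newt_pair_translate vf vg.
rewrite vol_pair1E vol_fullE; last exact: newt_translate_full tr.
by apply: volume3_le_translate tr; exact: conv_hull_convex.
Qed.

(** [dual_vertex] with the values of the pair written level by level. *)
Lemma pair2_vertex (R : realType) (a b z : int) (c wx wy wz : R) :
  tpoly_pair (num2 R) (den2 R) (row_mx (ipt a b) (const_mx z)) = Some c ->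
  (forall k, k \in (ipt 0 0 |` tri)%fset -> (k, 0) != (ipt a b, z) ->
     dotp (real_exp R k) (rpt wx wy) + coef R k <
     dotp (real_exp R (ipt a b)) (rpt wx wy) + z%:~R * wz + c) ->
  (forall k, k \in (ipt 0 0 |` (tri `|` outer))%fset -> (k, 1) != (ipt a b, z) ->
     dotp (real_exp R k) (rpt wx wy) + wz + coef R k <
     dotp (real_exp R (ipt a b)) (rpt wx wy) + z%:~R * wz + c) ->
  dual_subdivision (tpoly_pair (num2 R) (den2 R)) [set row3 a%:~R b%:~R z%:~R].
Proof.
move=> hc Hf Hg.
have dE k (y : int) : dotp (real_exp R (row_mx k (const_mx y : 'rV_1)))
  (row_mx (rpt wx wy) (const_mx wz)) = dotp (real_exp R k) (rpt wx wy) + y%:~R * wz.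
  by rewrite real_exp_row dotp_row_mx; congr (_ + _); rewrite /dotp big_ord1 !mxE.
have : row3 a%:~R b%:~R z%:~R = real_exp R (row_mx (ipt a b) (const_mx z : 'rV_1)).
  by rewrite real_exp_row real_exp_ipt row_mx_rpt.
move=> ->; apply: (@dual_vertex R _ _ _ c (row_mx (rpt wx wy) (const_mx wz))) => //.
move=> j e ji je.
have jn : tpoly_pair (num2 R) (den2 R) j <> None by rewrite je.
pose P (j : 'rV[int]_(2 + 1)) := forall e,
  j != row_mx (ipt a b) (const_mx z) -> tpoly_pair (num2 R) (den2 R) j = Some e ->
  dotp (real_exp R j) (row_mx (rpt wx wy) (const_mx wz)) + e <
  dotp (real_exp R (row_mx (ipt a b) (const_mx z : 'rV_1)))
    (row_mx (rpt wx wy) (const_mx wz)) + c.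
apply: (@tpoly_pair_supp _ _ _ _ P _ _ _ jn) ji je => k fk {}e ki;
  rewrite !dE tpoly_pairE /= poly_onE.
  case: ifPn => // kA [<-]; rewrite mul0r addr0; apply: Hf => //.
  by apply: contra ki => /eqP[-> <-].
case: ifPn => // kA [<-]; rewrite mul1r; apply: Hg => //.
by apply: contra ki => /eqP[-> <-].
Qed.

(** The weights of the last coordinate, -100 and 100, make one level dominate;
    within the level (10,0) selects the exponent (1,0), and 0 selects the largest
    coefficient. *)
Lemma pair2_vertices (R : realType) :
  dual_subdivision (tpoly_pair (num2 R) (den2 R)) [set row3 1 0 0] /\
  dual_subdivision (tpoly_pair (num2 R) (den2 R)) [set row3 0 0 1].
Proof.
split.
  apply: (@pair2_vertex R 1 0 0 0 10 0 (- 100)).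
  - by rewrite tpoly_pairE /= poly_onE /coef !in_fsetU !in_fset1 !ipt_eq.
  - move=> k; rewrite !in_fsetU !in_fset1 -!orbA => /or4P[] /eqP->;
      rewrite /coef !in_fsetU !in_fset1 !dotp_ipt !mxE !ipt_eq //=
        xpair_eqE ?ipt_eq ?eqxx //= => ?; lra.
  - move=> k; rewrite !in_fsetU !in_fset1 -!orbA.
    move=> /or4P[| | |/or4P[]] /eqP->;
      rewrite /coef !in_fsetU !in_fset1 !dotp_ipt !mxE !ipt_eq //=
        xpair_eqE ?ipt_eq ?eqxx //= => ?; lra.
apply: (@pair2_vertex R 0 0 1 1 0 0 100).
- by rewrite tpoly_pairE /= poly_onE /coef !in_fsetU !in_fset1 !ipt_eq.
- move=> k; rewrite !in_fsetU !in_fset1 -!orbA => /or4P[] /eqP->;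
    rewrite /coef !in_fsetU !in_fset1 !dotp_ipt !mxE !ipt_eq //=
        xpair_eqE ?ipt_eq ?eqxx //= => ?; lra.
- move=> k; rewrite !in_fsetU !in_fset1 -!orbA.
  move=> /or4P[| | |/or4P[]] /eqP->;
    rewrite /coef !in_fsetU !in_fset1 !dotp_ipt !mxE !ipt_eq //=
        xpair_eqE ?ipt_eq ?eqxx //= => ?; lra.
Qed.

Lemma not_translation (R : realType) :
  ~ is_translation (dual_subdivision (tpoly_pair (num1 R) (den1 R)))
                   (dual_subdivision (tpoly_pair (num2 R) (den2 R))).
Proof.
move=> [v tr]; have [V1 V2] := pair2_vertices R.
have supp p : dual_subdivision (tpoly_pair (num2 R) (den2 R)) [set p] ->
  exists2 i, tpoly_pair (num1 R) (den1 R) i <> None & p + v = real_exp R i.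
  move=> Vp; have : dual_subdivision (tpoly_pair (num1 R) (den1 R)) [set p + v].
    by rewrite tr; exists [set p] => //; rewrite image_set1.
  by move=> /dual_cell_exponent[i fi /= <-]; exists i.
pose T (q : 'rV[R]_3) := exists x y z : R, q = row3 x y z /\
  (z = 0 /\ [\/ x = 1 /\ y = 0, x = 0 /\ y = 1 | x = -1 /\ y = -1] \/
   z = 1 /\ ([\/ x = 1 /\ y = 0, x = 0 /\ y = 1 | x = -1 /\ y = -1] \/
     [\/ x = 1 /\ y = 1, x = -1 /\ y = 0 | x = 0 /\ y = -1])).
have expT i : tpoly_pair (num1 R) (den1 R) i <> None -> T (real_exp R i).
  move: i; apply: tpoly_pair_supp => j /eqP; rewrite -mem_finsupp => /(map_f (@real_exp R 2)).
    move=> /exps_num1 jE; exists (real_exp R j 0 0), (real_exp R j 0 1), 0.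
    rewrite real_exp_row -row_mx_rpt -rpt_eta; split=> //; left; split=> //.
    by case: jE => ->; rewrite real_exp_ipt !mxE; by [constructor 1|constructor 2|constructor 3].
  move=> /exps_den1 jE; exists (real_exp R j 0 0), (real_exp R j 0 1), 1.
  rewrite real_exp_row -row_mx_rpt -rpt_eta; split=> //; right; split=> //.
  case: jE => [/exps_num1|] jE; [left|right];
  by case: jE => ->; rewrite real_exp_ipt !mxE; by [constructor 1|constructor 2|constructor 3].
have [i1 /expT[x1 [y1 [z1 [-> A1]]]]] := supp _ V1.
have [i2 /expT[x2 [y2 [z2 [-> A2]]]]] := supp _ V2.
rewrite (row3_eta v) !row3D => /rowP e2 /rowP e1.
have := e2 0; have := e2 1; have := e2 2%:R; have := e1 0; have := e1 1; have := e1 2%:R.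
rewrite !mxE /= => *.
(* The second exponent is the first one plus (-1,0,1). *)
clear tr; have dx : x2 = x1 - 1 by lra.
have dy : y2 = y1 by lra.
have dz : z2 = z1 + 1 by lra.
case: A1 => [[z10 A1]|[z11 _]]; case: A2 => [[z20 _]|[z21 A2]]; try lra.
case: A1 => -[? ?]; case: A2 => -[] [? ?]; lra.
Qed.

Theorem proposition1p3 (R : realType) :
  exists (phi : 'rV[R]_2 -> \bar R) (f1 g1 f2 g2 : tpoly R 2),
    trop_rational phi /\
    g1 <> tpoly_ninfty R 2 /\ g2 <> tpoly_ninfty R 2 /\
    phi = trop_quot f1 g1 /\ phi = trop_quot f2 g2 /\
    (0 < vol f1 g1)%E /\ vol f1 g1 = vol f2 g2 /\
    (forall f g : tpoly R 2, g <> tpoly_ninfty R 2 ->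
       phi = trop_quot f g -> (vol f2 g2 <= vol f g)%E) /\
    ~ is_translation (dual_subdivision (tpoly_pair f1 g1))
                     (dual_subdivision (tpoly_pair f2 g2)).
Proof.
have ninf A : ipt 1 0 \in A -> poly_on R A <> tpoly_ninfty R 2.
  by move=> iA /fsfunP/(_ (ipt 1 0)); rewrite poly_onE iA fsfun0E.
have g1n : den1 R <> tpoly_ninfty R 2.
  by apply: ninf; rewrite !in_fsetU !in_fset1 eqxx.
have g2n : den2 R <> tpoly_ninfty R 2.
  by apply: ninf; rewrite !in_fsetU !in_fset1 eqxx orbT.
have volE : vol (num1 R) (den1 R) = vol (num2 R) (den2 R) by rewrite /vol same_newt.
exists (trop_quot (num1 R) (den1 R)), (num1 R), (den1 R), (num2 R), (den2 R).
split; first by exists (num1 R), (den1 R); split.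
split; first exact: g1n.
split; first exact: g2n.
split; first reflexivity.
split; first exact: same_quotient.
split.
  rewrite vol_pair1E; apply: (@volume3_gt0 R _ (1 / 4)); first lra.
    exact: conv_hull_convex.
  exact: newt_pair1_box.
split; first exact: volE.
split; last exact: not_translation.
by move=> f g g0 FG; rewrite -volE; exact: vol_minimal.
Qed.
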